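(* Let $M$ be a minimally vertically $4$-connected matroid with at least six elements such that $M$ is not isomorphic to $N_9$. Then $M$ has a $4$-element cocircuit, or a $5$-element cocircuit that contains a triangle.
   Context: For a matroid $M$ with ground set $E$ and rank function $r$, the connectivity function is $\lambda_M(X) = r(X) + r(E-X) - r(M)$. For a positive integer $j$, a partition $(X,Y)$ of $E$ is a vertical $j$-separation of $M$ if $\lambda_M(X) < j$ and $\min\{r(X), r(Y)\} \ge j$. For an integer $k \ge 2$, $M$ is vertically $k$-connected if it has no vertical $j$-separation with $j < k$. $M$ is minimally vertically $k$-connected if it is vertically $k$-connected and $M \setminus e$ is not vertically $k$-connected for every element $e$ of $M$. A triangle is a $3$-element circuit. $N_9$ is the $9$-element rank-$4$ matroid represented over $\mathrm{GF}(3)$ by the columns of the matrix $\begin{bmatrix} 1 & 0 & 0 & 0 & 0 & 1 & 1 & -1 & 1 \\ 0 & 1 & 0 & 0 & 1 & 0 & 1 & 1 & -1 \\ 0 & 0 & 1 & 0 & 1 & 1 & 0 & 1 & 1 \\ 0 & 0 & 0 & 1 & -1 & 1 & 1 & 0 & -1 \end{bmatrix}$. *)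

(* Defs.v *)
From HB Require Import structures.
From mathcomp Require Import all_boot all_order all_algebra.
Set Implicit Arguments.
Unset Strict Implicit.
Unset Printing Implicit Defensive.
Import GRing.Theory.

(* The ground set is a subset of an ambient finite type, so that deletion stays
   in the same type.  Values of [rk] outside the ground set are irrelevant:
   every notion below only evaluates [rk] on subsets of [ground]. *)
Record matroid (T : finType) := Matroid {
  ground : {set T};
  rk : {set T} -> nat;
  rk_le_card : forall X : {set T}, X \subset ground -> rk X <= #|X|;
  rk_mono : forall X Y : {set T}, X \subset Y -> Y \subset ground -> rk X <= rk Y;
  rk_submod : forall X Y : {set T}, X \subset ground -> Y \subset ground ->
    rk (X :|: Y) + rk (X :&: Y) <= rk X + rk Y
}.

Section MatroidTheory.
Variable T : finType.
Implicit Types (M : matroid T) (A B C X Y : {set T}) (e : T).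

Definition indep M X := (X \subset ground M) && (rk M X == #|X|).

Definition circuit M C :=
  minset (fun X => (X \subset ground M) && ~~ indep M X) C.

Definition triangle M C := circuit M C && (#|C| == 3).

Lemma rk_setD_le M A B : B \subset A -> A \subset ground M ->
  rk M A <= #|A :\: B| + rk M B.
Proof.
move=> sBA sAE.
have sDE : A :\: B \subset ground M by apply: subset_trans sAE; apply: subsetDl.
have sBE := subset_trans sBA sAE.
have := rk_submod sDE sBE.
rewrite setUC -{1}(setIidPr sBA) setID => h.
apply: leq_trans (leq_trans (leq_addr _ _) h) _.
by rewrite leq_add2r rk_le_card.
Qed.

Definition dual_rk M X := #|X| + rk M (ground M :\: X) - rk M (ground M).

Lemma dual_rk_add M X : X \subset ground M ->
  dual_rk M X + rk M (ground M) = #|X| + rk M (ground M :\: X).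
Proof.
move=> sX; rewrite /dual_rk subnK //.
have := rk_setD_le (subsetDl (ground M) X) (subxx _).
by rewrite setDDr setDv set0U (setIidPr sX).
Qed.

Fact dual_rk_le_card M X : X \subset ground M -> dual_rk M X <= #|X|.
Proof.
move=> sX; rewrite -(leq_add2r (rk M (ground M))) dual_rk_add // leq_add2l.
by apply: rk_mono; rewrite ?subsetDl.
Qed.

Fact dual_rk_mono M X Y : X \subset Y -> Y \subset ground M ->
  dual_rk M X <= dual_rk M Y.
Proof.
move=> sXY sY; have sX := subset_trans sXY sY.
rewrite -(leq_add2r (rk M (ground M))) !dual_rk_add //.
have /rk_setD_le h : ground M :\: Y \subset ground M :\: X by apply: setDS.
have {h} := h M (subsetDl _ _).
have -> : (ground M :\: X) :\: (ground M :\: Y) = Y :\: X.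
  apply/setP => x; rewrite !inE.
  by have := subsetP sY x; case: (x \in Y) => [->|_] //=;
     case: (x \in X); case: (x \in ground M).
move=> h; rewrite -(cardsID X Y) (setIidPr sXY) -addnA leq_add2l.
exact: h.
Qed.

Fact dual_rk_submod M X Y : X \subset ground M -> Y \subset ground M ->
  dual_rk M (X :|: Y) + dual_rk M (X :&: Y) <= dual_rk M X + dual_rk M Y.
Proof.
move=> sX sY.
have sU : X :|: Y \subset ground M by rewrite subUset sX.
have sI : X :&: Y \subset ground M by rewrite subIset // sX.
rewrite -(leq_add2r (rk M (ground M) + rk M (ground M))).
rewrite (addnACA (dual_rk M (X :|: Y))) (addnACA (dual_rk M X)) !dual_rk_add //.
rewrite (addnACA #|X :|: Y|) (addnACA #|X|) cardsUI leq_add2l setDUr setDIr addnC.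
by apply: rk_submod; rewrite subsetDl.
Qed.

Definition dual M := Matroid (@dual_rk_le_card M) (@dual_rk_mono M)
                             (@dual_rk_submod M).

Definition cocircuit M C := circuit (dual M) C.

Section Deletion.
Variables (M : matroid T) (e : T).
Let del_sub X (sX : X \subset ground M :\ e) : X \subset ground M :=
  subset_trans sX (subsetDl _ _).

Definition delete : matroid T :=
  @Matroid T (ground M :\ e) (rk M)
    (fun X sX => rk_le_card (del_sub sX))
    (fun X Y sXY sY => rk_mono sXY (del_sub sY))
    (fun X Y sX sY => rk_submod (del_sub sX) (del_sub sY)).
End Deletion.

(* For X inside the ground set the natural-number subtraction is not
   truncated, by submodularity. *)
Definition connectivity M X :=
  rk M X + rk M (ground M :\: X) - rk M (ground M).

Definition vertical_separation M (j : nat) X Y :=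
  [/\ X :|: Y = ground M, [disjoint X & Y], connectivity M X < j
    & j <= minn (rk M X) (rk M Y)].

Definition vertically_connected (k : nat) M :=
  forall j X Y, 0 < j -> j < k -> ~ vertical_separation M j X Y.

Definition minimally_vertically_connected (k : nat) M :=
  vertically_connected k M /\
  forall e, e \in ground M -> ~ vertically_connected k (delete M e).

End MatroidTheory.

(* [f] matters only on the ground set of [M]; as a total function it requires
   [T'] to be inhabited whenever [T] is. *)
Definition isomorphic (T T' : finType) (M : matroid T) (N : matroid T') :=
  exists f : T -> T',
    [/\ {in ground M &, injective f}, f @: ground M = ground N
      & forall X : {set T}, X \subset ground M -> rk N (f @: X) = rk M X].

Section VectorMatroid.
Variables (F : fieldType) (m n : nat) (A : 'M[F]_(m, n)).
Implicit Types X Y : {set 'I_n}.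

(* Columns are transposed because mxalgebra subspaces are row spaces. *)
Definition col_span X := (\sum_(j in X) <<(col j A)^T>>)%MS.

Lemma col_spanS X Y : X \subset Y -> (col_span X <= col_span Y)%MS.
Proof.
by move=> /subsetP sXY; apply/sumsmx_subP => j /sXY jY; apply: (sumsmx_sup j).
Qed.

Fact col_rk_le_card X : X \subset [set: 'I_n] -> \rank (col_span X) <= #|X|.
Proof.
move=> _; rewrite -sum1_card; apply: leq_trans (mxrank_sum_leqif _) _ => /=.
by apply: leq_sum => j _; rewrite /= mxrank_gen rank_leq_row.
Qed.

Fact col_rk_mono X Y : X \subset Y -> Y \subset [set: 'I_n] ->
  \rank (col_span X) <= \rank (col_span Y).
Proof. by move=> sXY _; apply/mxrankS/col_spanS. Qed.

Fact col_rk_submod X Y : X \subset [set: 'I_n] -> Y \subset [set: 'I_n] ->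
  \rank (col_span (X :|: Y)) + \rank (col_span (X :&: Y)) <=
  \rank (col_span X) + \rank (col_span Y).
Proof.
move=> _ _; rewrite -(mxrank_sum_cap (col_span X)) leq_add // mxrankS //.
  apply/sumsmx_subP => j /setUP[jX|jY].
    by apply: submx_trans (addsmxSl _ _); apply: (sumsmx_sup j).
  by apply: submx_trans (addsmxSr _ _); apply: (sumsmx_sup j).
by rewrite sub_capmx !col_spanS ?subsetIl ?subsetIr.
Qed.

Definition vector_matroid : matroid 'I_n :=
  Matroid col_rk_le_card col_rk_mono col_rk_submod.

End VectorMatroid.

Definition N9_mx : 'M['F_3]_(4, 9) :=
  (\matrix_(i < 4, j < 9)
    nth 0 (nth [::]
      [:: [:: 1; 0; 0; 0;  0; 1; 1; -1;  1];
          [:: 0; 1; 0; 0;  1; 0; 1;  1; -1];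
          [:: 0; 0; 1; 0;  1; 1; 0;  1;  1];
          [:: 0; 0; 0; 1; -1; 1; 1;  0; -1]] i) j)%R.

Definition N9 : matroid 'I_9 := vector_matroid N9_mx.

(* Main.v *)
(* Assume that M has neither of the two cocircuits: then every set S of at most
   four elements, or of five elements including a triangle, has a complement of
   full rank.  The case of rank at most 3 is elementary.  In higher rank the
   deletion of any element e has a vertical 3-separation (A, B) whose two sides
   do not span e; in particular lines have at most three points.  Choose e and A
   with |A| minimum.  Uncrossing (A, B) with the separations of M \ f for f in A
   gives 4 <= |A| <= 6.  If |A| = 6 every A - f is a triangle together with a
   two-point line, which no six points allow; if |A| = 5 then A spans a plane, and
   comparing the separations for two elements of A excludes every configuration
   of triangles in A.  If |A| = 4, the separations for two suitable elements of A
   cut B into four quadrants, three of which are single points; the fourth is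
   then so small that M has rank 4 and nine elements.  Such an M is determined by
   its four-point planes, and each E - g is a union of two of them; an exhaustive
   search shows that they are the planes of N9. *)

Require Import Defs.
From mathcomp Require Import all_boot all_order all_algebra.
From mathcomp Require Import zify.
Set Implicit Arguments.
Unset Strict Implicit.
Unset Printing Implicit Defensive.

(** Call the sum of the ranks of a set and of its opposite side its cost. Uncrossing two separations
    bounds the total cost of two opposite corners by [2 * R + 4]. A corner that is not too small
    costs at least [R + 2], because deletions have no vertical 2-separation once [R > 3]; a
    contradiction needs one more unit. It comes from [conn3] when the corner and its complement
    cover all of [T], and from the minimality of [#|A|] when the corner has fewer elements than [A].
    This is why the minimum is taken over the separations of all deletions at once. The complement
    belonging to [A :&: C] lacks two elements, so there [R + 2] is not automatic; for a corner of
    rank 2 the absence of the forbidden cocircuits supplies it. The bound 6 is [2 + 3 + 1]: at most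
    two points of [A] in [C], at most three on a line outside [C], and [f]. If two points lie in
    [C], the side opposite to [C] is itself of minimum size, and every result about [A] applies to
    it; the five-element case rests on this exchange. *)

Ltac known_membership :=
  repeat match goal with
  | H : is_true (?a \in ?A) |- context [?a \in ?A] => rewrite H
  | H : is_true (?a \notin ?A) |- context [?a \in ?A] => rewrite (negbTE H)
  | H : is_true (?a != ?b) |- context [?a == ?b] => rewrite (negbTE H)
  | H : is_true (?a != ?b) |- context [?b == ?a] => rewrite [b == a]eq_sym (negbTE H)
  end.

Ltac set_cases y :=
  rewrite ?inE;
  repeat match goal with
  | |- context [y == ?a] => case: (eqVneq y a) => [->|_]; known_membership; rewrite ?eqxx /=
  end;
  repeat match goal with
  | |- context [y \in ?A] => case: (y \in A) => //=
  end;
  rewrite ?(andbT, andbF, orbT, orbF) //=.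

Ltac set_auto :=
  let y := fresh "y" in
  first [ apply/subsetP => y; set_cases y | apply/setP => y; set_cases y ].

(* [lia] becomes very slow when it sees the boolean membership hypotheses. *)
Ltac nat_lia :=
  repeat match goal with
  | H : ?P |- _ =>
    lazymatch P with
    | @eq nat _ _ => fail
    | is_true (leq _ _) => fail
    | _ => clear H
    end
  end; lia.

(** * The matroid N9 *)

Section NineColumns.

(* [all] and [has] combine their values with the functions [andb] and [orb], whose
   arguments [vm_compute] evaluates eagerly; these variants stop early. *)
Section Lazy.
Variables (U : Type) (p : pred U).
Fixpoint lazy_all s := if s is x :: s' then if p x then lazy_all s' else false else true.
Fixpoint lazy_has s := if s is x :: s' then if p x then true else lazy_has s' else false.
Lemma lazy_allE s : lazy_all s = all p s. Proof. by elim: s => //= x s ->. Qed.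
Lemma lazy_hasE s : lazy_has s = has p s. Proof. by elim: s => //= x s ->. Qed.
End Lazy.

(** * Search for families of four-point planes *)

Fixpoint ksubseqs (k : nat) (l : seq nat) : seq (seq nat) :=
  match k, l with
  | 0, _ => [:: [::]]
  | _, [::] => [::]
  | k'.+1, x :: l' => [seq x :: s | s <- ksubseqs k' l'] ++ ksubseqs k l'
  end.

Lemma mem_ksubseqs s l : subseq s l -> s \in ksubseqs (size s) l.
Proof.
elim: l s => [|x l IH] [|y s] //= sub; rewrite ?mem_seq1 // mem_cat.
move: sub; case: eqP => [->|_] sub; apply/orP; last by right; apply: (IH (y :: s)).
by left; rewrite mem_map ?IH // => ? ? [].
Qed.

(** The four-sets of columns with vanishing determinant, as [N9_dets] confirms. *)
Definition N9_planes : seq (seq nat) :=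
  [:: [:: 0; 1; 2; 7]; [:: 0; 1; 3; 6]; [:: 0; 1; 4; 8]; [:: 0; 2; 3; 5];
      [:: 0; 2; 6; 8]; [:: 0; 3; 4; 7]; [:: 0; 4; 5; 6]; [:: 0; 5; 7; 8];
      [:: 1; 2; 3; 4]; [:: 1; 2; 5; 6]; [:: 1; 3; 5; 8]; [:: 1; 4; 5; 7];
      [:: 1; 6; 7; 8]; [:: 2; 3; 7; 8]; [:: 2; 4; 5; 8]; [:: 2; 4; 6; 7];
      [:: 3; 4; 6; 8]; [:: 3; 5; 6; 7]].

Definition lazy_mem (c : seq nat) (i : nat) := lazy_has (eqn i) c.

Lemma lazy_memE c i : lazy_mem c i = (i \in c).
Proof. by rewrite /lazy_mem lazy_hasE; elim: c => //= j c ->. Qed.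

Fixpoint meet_size (b c : seq nat) : nat :=
  if b is i :: b' then
    if lazy_mem c i then (meet_size b' c).+1 else meet_size b' c
  else 0.

Lemma meet_sizeE b c : meet_size b c = count (mem c) b.
Proof. by elim: b => //= i b ->; rewrite lazy_memE; case: (i \in c). Qed.

(* Distinct four-point planes of a rank-4 matroid without triangles and without
   five-point planes share at most two points. *)
Definition compat (b c : seq nat) := if meet_size b c <= 2 then true else b == c.

(* The partitions of the labels other than g into two four-sets, the first of which
   contains the least label. *)
Definition splits (g : nat) : seq (seq nat * seq nat) :=
  let o := rem g (iota 0 9) in
  [seq (head 0 o :: s, [seq i <- behead o | i \notin s]) | s <- ksubseqs 3 (behead o)].

(* The columns other than 8 split into the planes 0347 and 1256 of N9, which are to
   receive the labels 0123 and 4567. *)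
Definition placements : seq (seq nat) :=
  [seq s ++ t ++ [:: 8] | s <- permutations [:: 0; 3; 4; 7], t <- permutations [:: 1; 2; 5; 6]].

Lemma placements_perm : all (fun P => perm_eq P (iota 0 9)) placements.
Proof. by lazy. Qed.

(** The label of column [i] is its position in [P]. Containment in a member of [bs] is enough, since
    it bounds the rank by 3. *)
Definition placed (bs : seq (seq nat)) (P : seq nat) :=
  lazy_all (fun b => lazy_has (fun c => lazy_all (lazy_mem c) [seq index i P | i <- b]) bs) N9_planes.

(* Depth-first search over the families bs of planes that contain a split of every
   label; each complete family must contain the image of N9_planes under some
   placement. *)
Fixpoint all_packings_placed (n : nat) (bs : seq (seq nat)) : bool :=
  if n is g.+1 then
    lazy_all (fun xy =>
      if lazy_all (fun b => if compat xy.1 b then compat xy.2 b else false) bs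
      then all_packings_placed g [:: xy.1, xy.2 & bs] else true) (splits g)
  else lazy_has (placed bs) placements.

(** The two initial lists are the split of label 8, so only the labels 7 down to 0 are searched. *)
Lemma packings_of_8 : all_packings_placed 8 [:: [:: 0; 1; 2; 3]; [:: 4; 5; 6; 7]].
Proof. by vm_cast_no_check (erefl true). Qed.

(** The splits realised by [D] pass every compatibility test, so they form a branch that the search
    follows to its end. *)
Lemma all_packings_placedP (D : pred (seq nat)) n bs :
  (forall g, g < n -> exists2 xy, xy \in splits g & D xy.1 && D xy.2) ->
  (forall b c, D b -> D c -> compat b c) ->
  all D bs -> all_packings_placed n bs ->
  exists2 P, P \in placements & exists2 cs, all D cs & placed cs P.
Proof.
move=> hD cD; elim: n bs hD => [|g IH] bs hD aD.
  move=> h; have /hasP[P PP pl] : has (placed bs) placements by rewrite -lazy_hasE.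
  by exists P => //; exists bs.
have [xy xyS /andP[d1 d2]] := hD g (ltnSn g) => h.
have /allP/(_ _ xyS) : all (fun xy =>
    if lazy_all (fun b => if compat xy.1 b then compat xy.2 b else false) bs
    then all_packings_placed g [:: xy.1, xy.2 & bs] else true) (splits g).
  by rewrite -lazy_allE.
rewrite lazy_allE.
have -> : all (fun b => if compat xy.1 b then compat xy.2 b else false) bs.
  by apply/allP => b /(allP aD) Db; rewrite !cD.
move=> {}h; apply: (IH [:: xy.1, xy.2 & bs]) => //.
- by move=> k kg; apply: hD; apply: ltnW.
- by rewrite /= d1 d2.
Qed.

(** Planes cannot be added to those of [N9]: a further one would share three points with an existing
    one. So it is enough to find the images of [N9_planes] among the planes of a matroid. *)
Lemma N9_nonplane_meet :
  all (fun c => (c \in N9_planes) || has (fun b => count (mem b) c == 3) N9_planes)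
    (ksubseqs 4 (iota 0 9)).
Proof. by lazy. Qed.

Definition N9_bases := [seq c <- ksubseqs 4 (iota 0 9) | c \notin N9_planes].

(** A set inside a basis has its size as rank and a set containing a basis has rank 4, so only the
    planes are left to [N9_rank_unique]. *)
Lemma N9_bases_comparable :
  all (fun u => (u \in N9_planes) ||
      lazy_has (fun v => if lazy_all (lazy_mem v) u then true else lazy_all (lazy_mem u) v)
        N9_bases)
    (flatten [seq ksubseqs k (iota 0 9) | k <- iota 0 10]).
Proof. by lazy. Qed.

(** * Determinants of four columns *)

Local Open Scope ring_scope.
Import GRing.Theory.

(** Expansion along the first row, with matrices as functions of natural numbers so that the
    determinants over ['F_3] are found by evaluation. *)
Fixpoint laplace_det (F : comNzRingType) (n : nat) (M : nat -> nat -> F) : F :=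
  if n is n'.+1 then
    foldr +%R 0 [seq (-1) ^+ j * (M 0%N j * laplace_det n' (fun i k => M i.+1 (bump j k)))
                | j <- iota 0 n]
  else 1.

Lemma laplace_detE (F : comNzRingType) n (M : nat -> nat -> F) :
  \det (\matrix_(i < n, j < n) M i j) = laplace_det n M.
Proof.
elim: n M => [|n IH] M; first exact: det_mx00.
have foldE (G : nat -> F) m :
    foldr +%R 0 [seq G j | j <- iota 0 m] = \sum_(j < m) G j.
  by rewrite -(big_mkord xpredT G) unlock /index_iota subn0 /reducebig; elim: (iota 0 m) => //= ? ? ->.
rewrite (expand_det_row _ ord0); apply: etrans _ (esym (foldE (fun j => _) n.+1)).
apply: eq_bigr => j _; rewrite /cofactor mxE add0n mulrCA; congr (_ * (_ * _)).
apply: etrans _ (IH (fun i k => M i.+1 (bump j k))); congr (\det _).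
by apply/matrixP => i k; rewrite !mxE.
Qed.

Definition N9_entry (i j : nat) : 'F_3 :=
  nth 0 (nth [::]
    [:: [:: 1; 0; 0; 0;  0; 1; 1; -1;  1];
        [:: 0; 1; 0; 0;  1; 0; 1;  1; -1];
        [:: 0; 0; 1; 0;  1; 1; 0;  1;  1];
        [:: 0; 0; 0; 1; -1; 1; 1;  0; -1]] i) j.

Lemma N9_dets :
  all (fun c => (laplace_det 4 (fun k i => N9_entry i (nth 0%N c k)) == 0) == (c \in N9_planes))
    (ksubseqs 4 (iota 0 9)).
Proof. by lazy. Qed.

Local Close Scope ring_scope.

(** * The rank function of N9 *)

Lemma size_ksubseqs k l s : s \in ksubseqs k l -> size s = k.
Proof.
elim: l k s => [|x l IH] [|k] s //=; rewrite ?mem_seq1; try by move/eqP->.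
by rewrite mem_cat => /orP[/mapP[t /IH <- ->]|/IH].
Qed.

Lemma ksubseqs_subseq k l s : s \in ksubseqs k l -> subseq s l.
Proof.
elim: l k s => [|x l IH] [|k] s; rewrite /= ?mem_seq1 ?in_nil //; try by move/eqP->.
rewrite mem_cat => /orP[/mapP[t /IH sub ->]|/IH sub]; first by rewrite eqxx.
by apply: subseq_trans sub (subseq_cons l x).
Qed.

Definition ords (c : seq nat) : {set 'I_9} := [set i : 'I_9 | val i \in c].

Definition vals (U : {set 'I_9}) : seq nat := [seq val i | i <- enum U].

Lemma ords_vals U : ords (vals U) = U.
Proof. by apply/setP => i; rewrite inE (mem_map val_inj) mem_enum. Qed.

Lemma vals_ksubseqs U : vals U \in ksubseqs #|U| (iota 0 9).
Proof.
have <- : size (vals U) = #|U| by rewrite size_map -cardE.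
apply: mem_ksubseqs; rewrite -val_enum_ord; apply: map_subseq.
by rewrite [enum 'I_9]enumT; apply: filter_subseq.
Qed.

Lemma card_ords c : #|ords c| <= size c.
Proof.
rewrite cardE -(size_map val); apply: uniq_leq_size.
  by rewrite (map_inj_uniq val_inj) enum_uniq.
by move=> i /mapP[j]; rewrite mem_enum inE => jc ->.
Qed.

Lemma card_ords_uniq c : uniq c -> {subset c <= iota 0 9} -> #|ords c| = size c.
Proof.
move=> uc sub; apply/eqP; rewrite eqn_leq card_ords /=.
rewrite cardE -(size_map val); apply: uniq_leq_size => // i ic.
have i9 : i < 9 by have := sub i ic; rewrite mem_iota.
by apply/mapP; exists (Ordinal i9); rewrite // mem_enum inE.
Qed.

Definition N9_rank (U : {set 'I_9}) : nat :=
  if vals U \in N9_planes then 3 else minn #|U| 4.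

(** Used twice: for [N9] itself, and for a rank function pulled back along a labelling of nine
    points. A plane has rank at least 3 because its three-element subsets are not planes. *)
Lemma N9_rank_unique (rho : {set 'I_9} -> nat) :
  (forall U, rho U <= #|U|) -> (forall U V : {set 'I_9}, U \subset V -> rho U <= rho V) ->
  (forall U V, rho (U :|: V) <= rho U + rho V) -> (forall U, rho U <= 4) ->
  (forall c, c \in N9_planes -> rho (ords c) <= 3) ->
  (forall c, c \in N9_bases -> 4 <= rho (ords c)) ->
  forall U, rho U = N9_rank U.
Proof.
move=> rho_card rhoS rhoU rho4 planes bases.
have nonplane U : vals U \notin N9_planes -> rho U = minn #|U| 4.
  move=> nU; have cU : #|U| < 10 by have := max_card (mem U); rewrite card_ord.
  have inF : vals U \in flatten [seq ksubseqs k (iota 0 9) | k <- iota 0 10].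
    apply/flattenP; exists (ksubseqs #|U| (iota 0 9)); last exact: vals_ksubseqs.
    by apply/mapP; exists #|U|; rewrite ?mem_iota.
  case/orP: (allP N9_bases_comparable _ inF) => [|]; first by rewrite (negbTE nU).
  rewrite lazy_hasE => /hasP[v vB]; rewrite !lazy_allE.
  have eqmem (c c' : seq nat) : all (lazy_mem c) c' = all (mem c) c'.
    by apply: eq_all => i; apply: lazy_memE.
  rewrite !eqmem.
  have rv := bases v vB => cmp; move: vB; rewrite mem_filter => /andP[_ /size_ksubseqs sv].
  have cv := card_ords v; rewrite sv in cv.
  have le1 := rho_card U; have le2 := rho4 U.
  have [/allP sub|nsub] := boolP (all (mem v) (vals U)); last first.
    rewrite (negbTE nsub) in cmp; have : ords v \subset U.
      apply/subsetP => i; rewrite inE => /(allP cmp) /mapP[j]; rewrite mem_enum => jU.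
      by move/val_inj->.
    by move/rhoS; nat_lia.
  have sUV : U \subset ords v.
    by apply/subsetP => i iU; rewrite inE; apply: sub; rewrite (mem_map val_inj) mem_enum.
  have h1 := rhoU U (ords v :\: U); have h2 := cardsID U (ords v).
  have h3 := rho_card (ords v :\: U).
  have sV : ords v \subset U :|: (ords v :\: U).
    by apply/subsetP => i iv; rewrite !inE; case: (i \in U) => //=; rewrite inE in iv.
  have h4 := rhoS _ _ sV; rewrite (setIidPr sUV) in h2; nat_lia.
move=> U; rewrite /N9_rank; have [pU|nU] := boolP (vals U \in N9_planes); last exact: nonplane.
apply/eqP; rewrite eqn_leq; have := planes _ pU; rewrite ords_vals => -> /=.
have cU : #|U| = 4.
  rewrite cardE -(size_map val) -/(vals U).
  suff /allP/(_ _ pU)/eqP : all (fun c => size c == 4) N9_planes by [].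
  by [].
have /card_gt0P[x xU] : 0 < #|U| by rewrite cU.
have c3 : #|U :\ x| = 3 by have := cardsD1 x U; rewrite xU; nat_lia.
have <- : rho (U :\ x) = 3.
  rewrite nonplane ?c3 //; apply/negP => p3.
  have : size (vals (U :\ x)) = 4.
    suff /allP/(_ _ p3)/eqP : all (fun c => size c == 4) N9_planes by [].
    by [].
  by rewrite size_map -cardE c3.
exact: rhoS (subD1set _ _).
Qed.

Lemma N9_rk_four c : c \in ksubseqs 4 (iota 0 9) ->
  rk N9 (ords c) = \rank (\matrix_(k < 4, i < 4) N9_entry i (nth 0%N c k))%R.
Proof.
move=> cS; have sc := size_ksubseqs cS; have sub := mem_subseq (ksubseqs_subseq cS).
set N := (\matrix_(_, _) _)%R; apply: eqmx_rank; apply/andP; split.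
  apply/sumsmx_subP => j; rewrite inE => jc; rewrite genmxE.
  have k4 : index (val j) c < 4 by have := jc; rewrite -index_mem sc.
  suff -> : ((col j N9_mx)^T)%R = row (Ordinal k4) N by apply: row_sub.
  by apply/rowP => i; rewrite !mxE /= nth_index.
apply/row_subP => k.
have j9 : nth 0 c k < 9.
  have : nth 0 c k \in iota 0 9 by apply: sub; rewrite mem_nth // sc.
  by rewrite mem_iota.
apply: (sumsmx_sup (Ordinal j9)); first by rewrite inE mem_nth // sc.
rewrite genmxE; suff -> : row k N = ((col (Ordinal j9) N9_mx)^T)%R by apply: submx_refl.
by apply/rowP => i; rewrite !mxE.
Qed.

Lemma N9_rkE U : rk N9 U = N9_rank U.
Proof.
have sT (V : {set 'I_9}) : V \subset ground N9 by apply: subsetT.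
have det_rk c : c \in ksubseqs 4 (iota 0 9) -> (rk N9 (ords c) == 4) = (c \notin N9_planes).
  move=> cS; rewrite N9_rk_four // -[_ == 4]/(row_free _) row_free_unit unitmxE GRing.unitfE.
  rewrite (laplace_detE 4 (fun k i => N9_entry i (nth 0 c k))).
  by have /eqP -> := allP N9_dets _ cS.
apply: N9_rank_unique => {U}.
- by move=> U; apply: rk_le_card.
- by move=> U V UV; apply: rk_mono.
- by move=> U V; apply: leq_trans (rk_submod (sT U) (sT V)); apply: leq_addr.
- by move=> U; apply: rank_leq_col.
- move=> c cP; have cS : c \in ksubseqs 4 (iota 0 9).
    by apply: (allP (_ : all (mem (ksubseqs 4 (iota 0 9))) N9_planes)).
  have := det_rk c cS; rewrite cP /= => n4.
  have : rk N9 (ords c) <= 4 by apply: rank_leq_col.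
  by rewrite leq_eqVlt n4.
- by move=> c; rewrite mem_filter => /andP[cP cS]; move: (det_rk c cS); rewrite cP => /eqP ->.
Qed.
End NineColumns.
(** * Separations of single-element deletions *)

(* Here [r] is the rank function of a matroid whose ground set is all of [T]. *)
Section RankFunction.

Variables (T : finType) (r : {set T} -> nat).
Implicit Types (X Y S L A C U I : {set T}) (e f g x y : T).

Hypothesis rk_card : forall X, r X <= #|X|.
Hypothesis rkS : forall X Y, X \subset Y -> r X <= r Y.
Hypothesis rkUI : forall X Y, r (X :|: Y) + r (X :&: Y) <= r X + r Y.

Notation R := (r [set: T]).

Lemma rkUI_sub X Y U I : U \subset X :|: Y -> I \subset X :&: Y ->
  r U + r I <= r X + r Y.
Proof.
move=> sU sI; apply: leq_trans (rkUI X Y); apply: leq_add; exact: rkS.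
Qed.

Lemma rkT X : r X <= R. Proof. exact/rkS/subsetT. Qed.

Lemma rkU1 x X : r (x |: X) <= (r X).+1.
Proof.
have /= := @rkUI_sub [set x] X (x |: X) set0 (subxx _) (sub0set _).
by have := rk_card [set x]; rewrite cards1; lia.
Qed.

Definition opp e X := ~: (e |: X).

Lemma oppK e X : e \notin X -> opp e (opp e X) = X.
Proof. by move=> eX; rewrite /opp; set_auto. Qed.

Lemma opp_notin e X : e \notin opp e X.
Proof. by rewrite !inE eqxx. Qed.

Lemma card_opp e X : e \notin X -> #|X| + #|opp e X| + 1 = #|T|.
Proof. by move=> eX; have := cardsC (e |: X); rewrite cardsU1 eX -/(opp e X); lia. Qed.

(* (X, opp e X) is a vertical 3-separation of the deletion of e. *)
Definition sep e X :=
  [&& e \notin X, 2 < r X, 2 < r (opp e X) & r X + r (opp e X) == R + 2].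

Lemma sepP e X : reflect
  [/\ e \notin X, 2 < r X, 2 < r (opp e X) & r X + r (opp e X) = R + 2] (sep e X).
Proof. by apply: (iffP and4P) => -[? ? ? /eqP ?]; split=> //; apply/eqP. Qed.

Lemma sep_notin e X : sep e X -> e \notin X.
Proof. by case/sepP. Qed.

Lemma sep_opp e X : sep e X -> sep e (opp e X).
Proof.
by case/sepP=> eX h1 h2 h3; apply/sepP; rewrite oppK // opp_notin; split; lia.
Qed.

Lemma rkU1_sub g S X : S \subset X -> r (g |: X) = (r X).+1 ->
  r (g |: S) = (r S).+1.
Proof.
move=> sSX h; apply/eqP; rewrite eqn_leq rkU1 /=.
have u1 : g |: X \subset X :|: (g |: S) by set_auto.
have u2 : S \subset X :&: (g |: S) by rewrite subsetI sSX subsetUr.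
by have := rkUI_sub u1 u2; lia.
Qed.

(** * Simplicity and three-point lines *)

Section Unspanned.

Hypothesis unspanned : forall e, exists X,
  [/\ r (e |: X) = (r X).+1 & r (e |: opp e X) = (r (opp e X)).+1].

Lemma unspanned_rk1 x : r [set x] = 1.
Proof.
have [X [hX _]] := unspanned x; have := rkU1_sub (sub0set _) hX.
by have := rk_card set0; rewrite cards0 setU0; nat_lia.
Qed.

(** The side that contains [y] does not span [x], so [y] alone does not. *)
Lemma unspanned_rk2 x y : x != y -> r [set x; y] = 2.
Proof.
move=> xy; have [X [h1 h2]] := unspanned x.
have [yX|yX] := boolP (y \in X).
  by rewrite (rkU1_sub _ h1) ?sub1set // unspanned_rk1.
by rewrite (rkU1_sub _ h2) ?unspanned_rk1 // sub1set !inE negb_or eq_sym xy.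
Qed.

Lemma unspanned_rk_gt1 S : 1 < #|S| -> 1 < r S.
Proof.
case/card_gt1P=> x [y [xS yS xy]]; rewrite -(unspanned_rk2 xy).
by apply: rkS; apply/subsetP=> z; rewrite !inE => /orP[] /eqP->.
Qed.

(** Of three further points on a line through [x], two lie on the same side; they would span the
    line and with it [x]. *)
Lemma unspanned_line_card L : r L <= 2 -> #|L| <= 3.
Proof.
move=> rL; rewrite leqNgt; apply/negP => cL.
have /card_gt0P[x xL] : 0 < #|L| by nat_lia.
have [X [h1 h2]] := unspanned x.
have c1 := cardsD1 x L; rewrite xL in c1.
have c2 := cardsID X (L :\ x).
have key Z : r (x |: Z) = (r Z).+1 -> 1 < #|(L :\ x) :&: Z| -> False.
  move=> hZ m; have := rkU1_sub (subsetIr (L :\ x) Z) hZ.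
  have s : x |: ((L :\ x) :&: Z) \subset L by set_auto.
  by have := unspanned_rk_gt1 m; have := rkS s; nat_lia.
have [c3|c3] : 1 < #|(L :\ x) :&: X| \/ 1 < #|(L :\ x) :\: X| by nat_lia.
  exact: key h1 c3.
apply: (key _ h2); suff -> : (L :\ x) :&: opp x X = (L :\ x) :\: X by [].
by rewrite /opp; set_auto.
Qed.

End Unspanned.

Section HighRank.

Hypothesis R_ge4 : 3 < R.
Hypothesis conn2 : forall X, 1 < r X -> 1 < r (~: X) -> R + 2 <= r X + r (~: X).
Hypothesis conn3 : forall X, 2 < r X -> 2 < r (~: X) -> R + 3 <= r X + r (~: X).
Hypothesis sep_ex : forall e, exists X, sep e X.

(** If [X] spanned [e], then [e |: X] and [opp e X] would have ranks summing to [R + 2], against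
    [conn3]. *)
Lemma sep_rkU1 e X S : sep e X -> S \subset X -> r (e |: S) = (r S).+1.
Proof.
case/sepP=> eX h1 h2 h3 sSX; apply: rkU1_sub sSX _.
apply/eqP; rewrite eqn_leq rkU1 /=.
have := conn3 (X := e |: X); rewrite -/(opp e X).
by have := rkS (subsetUr [set e] X); lia.
Qed.

Lemma sep_rkU1_opp e X S : sep e X -> S \subset opp e X -> r (e |: S) = (r S).+1.
Proof. by move/sep_opp; apply: sep_rkU1. Qed.

(** By [conn2], adding [e] to either side gives at least [R + 2], so a smaller sum is [R + 1] and
    both additions raise the rank. Then [conn3] forces both sides to have rank 2, whence [R = 3],
    against [R_ge4]. *)
Lemma del_conn2 e S : e \notin S -> 1 < r S -> 1 < r (opp e S) ->
  R + 2 <= r S + r (opp e S).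
Proof.
move=> eS h1 h2; rewrite leqNgt; apply/negP => h3.
have c1 := rkU1 e S; have c2 := rkU1 e (opp e S).
have m1 := rkS (subsetUr [set e] S).
have m2 := rkS (subsetUr [set e] (opp e S)).
have E1 : ~: (e |: opp e S) = S by rewrite -[RHS](oppK eS).
have a1 := conn2 (X := e |: S); have a2 := conn2 (X := e |: opp e S).
have b1 := conn3 (X := e |: S); have b2 := conn3 (X := e |: opp e S).
rewrite -/(opp e S) E1 in a1 a2 b1 b2.
lia.
Qed.

Let unspanned e : exists X,
  [/\ r (e |: X) = (r X).+1 & r (e |: opp e X) = (r (opp e X)).+1].
Proof.
have [X hX] := sep_ex e; exists X; split; first exact: sep_rkU1 hX _.
exact: sep_rkU1_opp hX _.
Qed.

Let rk1 := unspanned_rk1 unspanned.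
Let rk2 := unspanned_rk2 unspanned.
Let rk_gt1 := unspanned_rk_gt1 unspanned.
Let line_card := unspanned_line_card unspanned.

Lemma rk_gt0 S : 0 < #|S| -> 0 < r S.
Proof. by case/card_gt0P=> x xS; rewrite -(rk1 x); apply: rkS; rewrite sub1set. Qed.

Lemma rk_gt2 S : 3 < #|S| -> 2 < r S.
Proof. by move=> cS; rewrite ltnNge; apply/negP => /line_card; nat_lia. Qed.

(* The failure of the conclusion of the theorem; cocircuits with fewer than four
   elements are excluded by connectivity. *)
Hypothesis small4 : forall S, #|S| <= 4 -> r (~: S) = R.
Hypothesis small5 : forall S L, #|S| <= 5 -> L \subset S -> #|L| = 3 -> r L <= 2 ->
  r (~: S) = R.

(** Lines have at most three points, so [S] has at most five, and if it has five then [L] has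
    three. *)
Lemma small S L : L \subset S -> r L <= 2 -> #|S :\: L| <= 2 -> r (~: S) = R.
Proof.
move=> sLS rL cSL; have cL := line_card rL.
have cS := cardsID L S; rewrite (setIidPr sLS) in cS.
have [c4|c4] := leqP #|S| 4; first exact: small4.
by apply: (small5 (L := L)) => //; lia.
Qed.

(** * Minimum sides and uncrossing *)

Definition minsep e A := sep e A /\ forall f X, sep f X -> #|A| <= #|X|.

(** Submodularity for [A], [C] and for their opposite sides. Both [e] and [f] lie in [A :|: C],
    whose complement is thus the full one, while the complement belonging to [A :&: C] lacks
    both. *)
Lemma uncross_side e A f C : sep e A -> sep f C -> e \in C -> f \in A ->
  r (A :|: C) + r (~: (A :|: C)) + (r (A :&: C) + r (~: (e |: (f |: (A :&: C)))))
    <= 2 * R + 4.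
Proof.
move=> hA hC eC fA; have eA := sep_notin hA; have fC := sep_notin hC.
case/sepP: hA => _ _ _ sA; case/sepP: hC => _ _ _ sC.
have h1 : ~: (e |: (f |: (A :&: C))) \subset opp e A :|: opp f C.
  by rewrite /opp; set_auto.
have h2 : ~: (A :|: C) \subset opp e A :&: opp f C by rewrite /opp; set_auto.
by have := rkUI A C; have := rkUI_sub h1 h2; lia.
Qed.

(** Submodularity for [A] with [opp f C] and for [opp e A] with [C]. Each corner belongs to the
    deletion of a single element, so [del_conn2] and minimality apply to it. *)
Lemma uncross_cross e A f C : sep e A -> sep f C -> e \in C -> f \in A ->
  r ((A :\: C) :\ f) + r (opp f ((A :\: C) :\ f)) +
  (r ((C :\: A) :\ e) + r (opp e ((C :\: A) :\ e))) <= 2 * R + 4.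
Proof.
move=> hA hC eC fA; have eA := sep_notin hA; have fC := sep_notin hC.
case/sepP: hA => _ _ _ sA; case/sepP: hC => _ _ _ sC.
have h1 : opp e ((C :\: A) :\ e) \subset A :|: opp f C by rewrite /opp; set_auto.
have h2 : (A :\: C) :\ f \subset A :&: opp f C by rewrite /opp; set_auto.
have h3 : opp f ((A :\: C) :\ f) \subset opp e A :|: C by rewrite /opp; set_auto.
have h4 : (C :\: A) :\ e \subset opp e A :&: C by rewrite /opp; set_auto.
have := rkUI_sub h1 h2; have := rkUI_sub h3 h4.
lia.
Qed.

Lemma sep_side f e : e != f -> exists2 C, sep f C & e \in C.
Proof.
move=> ef; have [C hC] := sep_ex f.
have [eC|eC] := boolP (e \in C); first by exists C.
by exists (opp f C); [exact: sep_opp | rewrite !inE negb_or ef].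
Qed.

Lemma minsep_sub e A f X : minsep e A -> f \notin X -> #|X| < #|A| ->
  2 < r X -> 2 < r (opp f X) -> R + 3 <= r X + r (opp f X).
Proof.
move=> [_ minA] fX cX h1 h2.
have h3 := del_conn2 fX (ltnW h1) (ltnW h2).
rewrite leqNgt; apply/negP => h4.
have /minA : sep f X by apply/sepP; split=> //; lia.
lia.
Qed.

(** A spanned [g] could be moved to the other side, leaving a smaller separation. This fails only if
    [A :\ g] has rank at most 2; then [small] gives [opp e A] full rank, which contradicts
    [2 < r A]. *)
Lemma minsep_closed e A g : minsep e A -> g \in A ->
  r (g |: opp e A) = (r (opp e A)).+1.
Proof.
move=> [hA minA] gA; case/sepP: (hA) => eA h1 h2 h3.
apply/eqP; rewrite eqn_leq rkU1 /= ltnNge; apply/negP => h4.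
have cA := cardsD1 g A; rewrite gA in cA.
have eX : e \notin A :\ g by set_cases e.
have oppX : opp e (A :\ g) = g |: opp e A.
  by have ge : e != g by [apply: contraNneq eA => ->]; rewrite /opp; set_auto.
have m1 := rkS (subsetUr [set g] (opp e A)).
have [rX|rX] := ltnP 2 (r (A :\ g)).
  have := minA e (A :\ g); have := del_conn2 eX (ltnW rX).
  rewrite oppX => a1 a2; have m2 := rkS (subD1set A g).
  have : sep e (A :\ g) by apply/sepP; rewrite oppX; split=> //; lia.
  by move/a2; lia.
have := @small (e |: (A :\ g)) (A :\ g) (subsetUr _ _) rX.
have -> : (e |: A :\ g) :\: (A :\ g) = [set e] by set_auto.
by rewrite cards1 -/(opp e _) oppX => /(_ isT); lia.
Qed.

Lemma minsep_rkU1 e A g S : minsep e A -> g \in A -> S \subset opp e A ->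
  r (g |: S) = (r S).+1.
Proof. by move=> hA gA sS; apply: rkU1_sub sS (minsep_closed hA gA). Qed.

(** Otherwise [e |: A] is a line with at most two more elements, so [opp e A] has full rank and [A]
    has rank only 2. *)
Lemma minsep_coline e A L : minsep e A -> L \subset A -> r L <= 2 ->
  1 < #|A :\: L|.
Proof.
move=> [/sepP[eA h1 h2 h3] _] sL rL; rewrite ltnNge; apply/negP => cL.
have := @small (e |: A) L (subset_trans sL (subsetUr _ _)) rL.
have := cardsU1 e (A :\: L).
have -> : e |: A :\: L = (e |: A) :\: L.
  by have eL : e \notin L by [apply: contra eA; apply/subsetP]; set_auto.
by rewrite -/(opp e A); lia.
Qed.

Lemma minsep_card_ge4 e A : minsep e A -> 3 < #|A|.
Proof.
move=> hA; case: (hA) => /sepP[eA h1 h2 h3] _.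
rewrite ltnNge; apply/negP => cA.
have := @small4 (e |: A); rewrite cardsU1 eA -/(opp e A).
by have := rk_card A; lia.
Qed.

(** Replacing a point [y] of [A] off [L] by [e] leaves a line with at most two more elements. So
    [y |: opp e A] has full rank, [opp e A] has rank at least [R - 1], and [A] at most 3. *)
Lemma minsep_plane e A L : minsep e A -> L \subset A -> r L <= 2 ->
  #|A :\: L| <= 2 -> r A = 3.
Proof.
move=> hA sL rL cL; case: (hA) => /sepP[eA h1 h2 h3] _.
have cL1 := minsep_coline hA sL rL.
apply/eqP; rewrite eqn_leq h1 andbT leqNgt; apply/negP => h4.
have /card_gt0P[y] : 0 < #|A :\: L| by lia.
rewrite inE => /andP[yL yA].
have ye : y != e by apply: contraNneq eA => <-.
have eL : e \notin L by apply: contra eA; apply/subsetP.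
have E1 : ~: ((e |: A) :\ y) = y |: opp e A.
  by rewrite /opp; set_auto.
have E2 : (e |: A) :\ y :\: L = e |: ((A :\: L) :\ y) by set_auto.
have sL' : L \subset (e |: A) :\ y.
  apply/subsetP => z zL; rewrite !inE (subsetP sL z zL) orbT andbT.
  by apply: contraNneq yL => <-.
have := small sL' rL; rewrite E1 E2.
have := cardsU1 e ((A :\: L) :\ y); have := cardsD1 y (A :\: L).
rewrite !inE yL yA /= => c1 c2.
by move: (rkU1 y (opp e A)) h3 cL cL1 h4; case: (e \notin _) c2 c1; clear; lia.
Qed.

Lemma card_cross e A f C : e \notin A -> f \notin C -> e \in C -> f \in A ->
  [/\ #|A| = #|A :&: C| + #|(A :\: C) :\ f| + 1,
      #|C| = #|A :&: C| + #|(C :\: A) :\ e| + 1 &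
      #|opp f C| = #|(A :\: C) :\ f| + #|~: (A :|: C)|].
Proof.
move=> eA fC eC fA.
have := cardsID C A; have := cardsD1 f (A :\: C); rewrite inE fA fC /=.
have := cardsID A C; have := cardsD1 e (C :\: A); rewrite inE eA eC /=.
rewrite [C :&: A]setIC; have := cardsID A (opp f C).
have -> : opp f C :&: A = (A :\: C) :\ f by rewrite /opp; set_auto.
have -> : opp f C :\: A = ~: (A :|: C) by rewrite /opp; set_auto.
by split; lia.
Qed.

Lemma minsep_cross e A f C : minsep e A -> f \in A -> sep f C -> e \in C ->
  [/\ r ((A :\: C) :\ f) <= 2, #|(A :\: C) :\ f| <= 3, #|A :&: C| <= 2 &
    #|A :&: C| = 2 ->
      [/\ r (~: (A :|: C)) <= 2, #|~: (A :|: C)| = 3 & minsep f (opp f C)]].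
Proof.
move=> hA fA hC eC; case: (hA) => sA minA.
have eA := sep_notin sA; have fC := sep_notin hC.
have [c1 c2 c3] := card_cross eA fC eC fA.
have m1 := minA _ _ hC; have m2 := minA _ _ (sep_opp hC).
case/sepP: (sA) => _ a1 a2 a3.
set P := (A :\: C) :\ f in c1 c3 *; set N := A :&: C in c1 c2 *.
set Q := (C :\: A) :\ e in c2 *; set W := ~: (A :|: C) in c3 *.
(* Otherwise [P] costs [R + 3] by minimality, so [Q] costs at most [R + 1] and has at most one
   element; but [#|A| <= #|C|] gives [#|P| <= #|Q|]. *)
have rP : r P <= 2.
  rewrite leqNgt; apply/negP => rP.
  have fP : f \notin P by rewrite /P !inE eqxx.
  have eQ : e \notin Q by rewrite /Q !inE eqxx.
  have s1 : opp e A \subset opp f P by rewrite /P /opp; set_auto.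
  have s2 : A \subset opp e Q by rewrite /Q /opp; set_auto.
  have k1 := minsep_sub hA fP _ rP _; have k2 := del_conn2 eQ.
  have k3 := uncross_cross sA hC eC fA; rewrite -/P -/Q in k3.
  have := rkS s1; have := rkS s2.
  have := rk_card P.
  have [q|q] := ltnP 1 #|Q|.
    by move: (rk_gt1 q) c1 k1 k2 k3 a1 a2 rP; clear; lia.
  by move: c1 c2 m1 q rP; clear; lia.
(* Otherwise [A :|: C] costs [R + 3], leaving [R + 1] for [N]. Yet [N] costs [R + 2]: by [small] if
   its rank is 2, and else by minimality, less one for the loss of [e]. *)
have W2 : 1 < #|N| -> r W <= 2.
  move=> cN; rewrite leqNgt; apply/negP => rW.
  have k3 := uncross_side sA hC eC fA; rewrite -/N -/W in k3.
  have k4 := conn3 (X := A :|: C); have := rkS (subsetUl A C).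
  rewrite -/W in k4.
  suff : R + 2 <= r N + r (~: (e |: (f |: N))) by lia.
  have [rN|rN] := leqP (r N) 2.
    have := @small (e |: (f |: N)) N; rewrite setUA subsetUr => /(_ isT rN) ->.
      by have := rk_gt1 cN; lia.
    apply: leq_trans (subset_leq_card (_ : _ \subset [set e; f])) _.
      by rewrite /N; set_auto.
    by rewrite cards2; case: (_ != _).
  have fN : f \notin N by rewrite /N !inE negb_and fC orbT.
  have s1 : opp e A \subset opp f N by rewrite /N /opp; set_auto.
  have k1 := minsep_sub hA fN _ rN _; have := rkS s1.
  have s2 : opp f N \subset e |: ~: (e |: (f |: N)) by rewrite /opp; set_auto.
  move: (rkS s2) (rkU1 e (~: (e |: (f |: N)))) k1 rN a2 c1; clear; lia.
have cW : 1 < #|N| -> #|W| <= 3 by move/W2/line_card.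
(* As [opp f C] is no smaller than [A], [W] has more elements than [N]. *)
have cN : #|N| <= 2 by rewrite leqNgt; apply/negP => cN; have := cW (ltnW cN); lia.
split=> //; first exact: line_card.
move=> N2; rewrite N2 in cW W2; have := cW isT; have rW := W2 isT => cW3.
split=> //; first lia.
by split=> [|g X /minA]; [exact: sep_opp | lia].
Qed.

Lemma minsep_card_le6 e A : minsep e A -> #|A| <= 6.
Proof.
move=> hA; have /card_gt0P[f fA] : 0 < #|A| by have := minsep_card_ge4 hA; lia.
have eA := sep_notin (proj1 hA).
have ef : e != f by apply: contraNneq eA => ->.
have [C hC eC] := sep_side ef.
have [_ c1 c2 _] := minsep_cross hA fA hC eC.
have [c3 _ _] := card_cross eA (sep_notin hC) eC fA.
lia.
Qed.

Lemma minsep5_rk e A : minsep e A -> #|A| = 5 -> r A = 3.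
Proof.
move=> hA cA.
have /card_gt0P[f fA] : 0 < #|A| by lia.
have eA := sep_notin (proj1 hA).
have ef : e != f by apply: contraNneq eA => ->.
have [C hC eC] := sep_side ef; have fC := sep_notin hC.
have [rP cP cN kN] := minsep_cross hA fA hC eC.
have [c3 _ c4] := card_cross eA fC eC fA.
have sPA : (A :\: C) :\ f \subset A by set_auto.
have cAP := cardsID ((A :\: C) :\ f) A; rewrite (setIidPr sPA) in cAP.
have [p3|p3] : #|(A :\: C) :\ f| = 3 \/ #|(A :\: C) :\ f| = 2 by nat_lia.
  by apply: (minsep_plane hA sPA rP); nat_lia.
have [rW cW hD] : [/\ r (~: (A :|: C)) <= 2, #|~: (A :|: C)| = 3 & minsep f (opp f C)].
  by apply: kN; nat_lia.
have sWD : ~: (A :|: C) \subset opp f C by rewrite /opp; set_auto.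
have cDW := cardsID (~: (A :|: C)) (opp f C); rewrite (setIidPr sWD) in cDW.
have rD : r (opp f C) = 3 by apply: (minsep_plane hD sWD rW); nat_lia.
(* The plane [opp f C] is spanned by [d] and the triangle outside [A], so it lies in the span of
   [d |: opp e A]. What is left of [A], together with [e], has four elements, so that span is
   everything and [opp e A] has rank at least [R - 1]. *)
have /card_gt0P[d dP] : 0 < #|(A :\: C) :\ f| by nat_lia.
have rdW : r (d |: ~: (A :|: C)) = 3.
  rewrite (minsep_rkU1 hA (subsetP sPA d dP)); last by rewrite /opp; set_auto.
  by move: (@rk_gt1 (~: (A :|: C))) rW cW; clear; lia.
move: dP; rewrite !inE => /and3P[df dC dA].
have := @rkUI_sub (opp f C) (d |: opp e A) (((A :\: C) :\ f) :|: opp e A) (d |: ~: (A :|: C)).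
rewrite rD rdW => /(_ _ _)/wrap[]; rewrite /opp.
- by set_auto.
- by set_auto.
rewrite -/(opp e A); have := rkU1 d (opp e A) => u1 u2.
case: (hA) => /sepP[_ a1 a2 a3] _.
have := @small4 (e |: (A :\: ((A :\: C) :\ f))).
have -> : ~: (e |: (A :\: ((A :\: C) :\ f))) = ((A :\: C) :\ f) :|: opp e A.
  by have de : d != e by [apply: contraNneq eA => <-]; rewrite /opp; set_auto.
have := cardsU1 e (A :\: ((A :\: C) :\ f)).
move: u2 a1 a2 a3 rD rdW cN cP; rewrite -/(opp e A); case: (_ \notin _) => /= u2 a1 a2 a3 rD rdW cN cP ->.
  by move: cA c3 p3 cAP u1 u2 a1 a2 a3; clear; lia.
by move: cA c3 p3 cAP u1 u2 a1 a2 a3; clear; lia.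
Qed.

(** * Minimum sides with six or five elements *)

Definition tri L := (#|L| == 3) && (r L <= 2).

Lemma triP L : reflect (#|L| = 3 /\ r L <= 2) (tri L).
Proof. by apply: (iffP andP) => -[/eqP]. Qed.

Lemma tri_meet L1 L2 : tri L1 -> tri L2 -> L1 != L2 -> #|L1 :&: L2| <= 1.
Proof.
move=> /triP[c1 r1] /triP[c2 r2] neq; rewrite leqNgt; apply/negP => c3.
have c4 := cardsUI L1 L2; have := rkUI L1 L2; have := rk_gt1 c3 => r3 r4.
have c5 : #|L1 :|: L2| <= 3 by apply: line_card; nat_lia.
case/negP: neq; rewrite eqEcard c1 c2 leqnn andbT.
have <- : L1 :|: L2 = L2.
  by apply/esym/eqP; rewrite eqEcard subsetUr; nat_lia.
exact: subsetUl.
Qed.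

(** Size 6 makes both bounds of [minsep_cross] tight: [L] is the corner outside a side [C], and the
    remaining pair is [A :&: C]. A triangle of [A] through this pair has its third point outside
    [C], where [C] spans nothing. *)
Lemma minsep6_cut e A f : minsep e A -> #|A| = 6 -> f \in A ->
  exists L, [/\ tri L, L \subset A :\ f, #|(A :\ f) :\: L| = 2 &
    forall L', tri L' -> L' \subset A -> (A :\ f) :\: L \subset L' -> False].
Proof.
move=> hA cA fA; have eA := sep_notin (proj1 hA).
have ef : e != f by apply: contraNneq eA => ->.
have [C hC eC] := sep_side ef; have fC := sep_notin hC.
have [rP cP cN kN] := minsep_cross hA fA hC eC.
have [c3 _ c4] := card_cross eA fC eC fA.
have N2 : #|A :&: C| = 2 by nat_lia.
have [rW cW hD] := kN N2.
have QE : (A :\ f) :\: ((A :\: C) :\ f) = A :&: C.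
  by set_auto.
exists ((A :\: C) :\ f); rewrite QE; split=> //.
- by apply/triP; split=> //; nat_lia.
- by set_auto.
move=> L' /triP[c5 r5] sL' sQ.
have := cardsID (A :&: C) L'; rewrite (setIidPr sQ) => c6.
have /card_gt0P[x] : 0 < #|L' :\: (A :&: C)| by nat_lia.
rewrite inE => /andP[xN xL]; have xA := subsetP sL' x xL.
have xC : x \notin C by apply: contra xN => xC; rewrite inE xA.
have : r (x |: (A :&: C)) = (r (A :&: C)).+1.
  have [->|xf] := eqVneq x f; first by rewrite (sep_rkU1 hC) ?subsetIr.
  have xD : x \in opp f C by rewrite !inE negb_or xf.
  by rewrite (minsep_rkU1 hD xD) // oppK // subsetIr.
have := @rk_gt1 (A :&: C).
have := @rkS (x |: (A :&: C)) L'; rewrite subUset sub1set xL sQ.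
by move: N2 r5; clear; lia.
Qed.

(** [L1] consists of [f], [g] and [h]. The triangle [L2] chosen for [f] contains [g], and [L3],
    chosen for [g], contains [f]; together they cover [A :\ h]. The triangle chosen for [h] then has
    at most one point on each of them. *)
Lemma minsep_card_neq6 e A : minsep e A -> #|A| = 6 -> False.
Proof.
move=> hA cA; have cut f := minsep6_cut hA cA (f := f).
have /card_gt0P[f0 f0A] : 0 < #|A| by nat_lia.
have [L1 [t1 s1 _ _]] := cut _ f0A.
have {s1}s1 := subset_trans s1 (subD1set _ _).
have card3 L : tri L -> #|L| = 3 by case/triP.
have meet1 L f L' : tri L -> L \subset A -> f \in L -> tri L' ->
    L' \subset A :\ f -> #|(A :\ f) :\: L'| = 2 ->
    (forall M, tri M -> M \subset A -> (A :\ f) :\: L' \subset M -> False) ->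
    #|L :&: L'| = 1.
  move=> tL sL fL tL' sL' cQ k; apply/eqP; rewrite eqn_leq tri_meet //=; last first.
    by apply: contraTneq fL => ->; have /subsetD1P[] := sL'.
  rewrite lt0n cards_eq0; apply/negP => /eqP dis.
  have cD := cardsD1 f L; rewrite fL (card3 _ tL) in cD.
  have sQ : L :\ f \subset (A :\ f) :\: L'.
    apply/subsetP => x; rewrite !inE => /andP[xf xL].
    rewrite xf (subsetP sL x xL) !andbT; apply/negP => xL'.
    by have : x \in L :&: L' by [rewrite inE xL]; rewrite dis inE.
  apply: (k L) => //.
  have /eqP <- : L :\ f == (A :\ f) :\: L' by rewrite eqEcard sQ cQ; nat_lia.
  exact: subD1set.
have /card_gt0P[f fL1] : 0 < #|L1| by rewrite card3.
have fA := subsetP s1 f fL1.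
have [L2 [t2 s2 q2 k2]] := cut _ fA.
have m12 := meet1 _ _ _ t1 s1 fL1 t2 s2 q2 k2.
have /subsetD1P[s2A f2] := s2.
have /card_gt0P[g] : 0 < #|L1 :&: L2| by rewrite m12.
rewrite inE => /andP[gL1 gL2]; have gA := subsetP s1 g gL1.
have [L3 [t3 s3 q3 k3]] := cut _ gA.
have m13 := meet1 _ _ _ t1 s1 gL1 t3 s3 q3 k3.
have m23 := meet1 _ _ _ t2 s2A gL2 t3 s3 q3 k3.
have /subsetD1P[s3A g3] := s3.
have c3 := cardsID L2 L3; rewrite [L3 :&: L2]setIC m23 (card3 _ t3) in c3.
have f3 : f \in L3.
  apply/negPn/negP => f3; apply: (k2 L3) => //.
  suff /eqP <- : L3 :\: L2 == (A :\ f) :\: L2 by apply: subsetDl.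
  rewrite eqEcard q2; apply/andP; split; last nat_lia.
  by apply: setSD; apply/subsetD1P.
have /card_gt0P[h] : 0 < #|L1 :\ f :\ g|.
  have := cardsD1 f L1; have := cardsD1 g (L1 :\ f).
  rewrite fL1 !inE gL1 (card3 _ t1); case: eqP => [gf|] /=; last nat_lia.
  by move: f2; rewrite -gf gL2.
rewrite !inE => /and3P[hg hf h1]; have hA1 := subsetP s1 h h1.
have uniq1 L x y : #|L1 :&: L| = 1 -> x \in L1 -> x \in L -> y \in L1 -> y \in L -> x = y.
  by move/eqP/cards1P => [z /setP hz] x1 x2 y1 y2; move: (hz x) (hz y);
     rewrite !inE x1 x2 y1 y2 => /esym/eqP -> /esym/eqP ->.
have h2 : h \notin L2.
  by apply/negP => h2; move: hg; rewrite (uniq1 L2 h g) ?eqxx.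
have h3 : h \notin L3.
  by apply/negP => h3; move: hf; rewrite (uniq1 L3 h f) ?eqxx.
have U23 : L2 :|: L3 = A :\ h.
  apply/eqP; rewrite eqEcard subUset !subsetD1 s2A s3A h2 h3 /=.
  by have := cardsUI L2 L3; have := cardsD1 h A; rewrite hA1 m23 (card3 _ t2) (card3 _ t3); nat_lia.
have [L4 [t4 s4 q4 k4]] := cut _ hA1.
have n42 : L4 != L2.
  apply/eqP => E; apply: (k4 L3) => //.
  by rewrite -U23 E setDUl setDv set0U subsetDl.
have n43 : L4 != L3.
  apply/eqP => E; apply: (k4 L2) => //.
  by rewrite -U23 E setDUl setDv setU0 subsetDl.
have := tri_meet t4 t2 n42; have := tri_meet t4 t3 n43.
have := cardsUI (L4 :&: L2) (L4 :&: L3).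
by rewrite -setIUr U23 (setIidPl s4) (card3 _ t4); nat_lia.
Qed.

(** Asking for [e \in C] only orients the separation, since [sep_opp] swaps its sides. *)
Definition cut e A f C := [/\ f \in A, sep f C & e \in C].

Lemma minsep_cut e A f : minsep e A -> f \in A -> exists C, cut e A f C.
Proof.
move=> hA fA; have eA := sep_notin (proj1 hA).
have ef : e != f by apply: contraNneq eA => ->.
by have [C hC eC] := sep_side ef; exists C.
Qed.

Lemma cut_rkU1 f C x S : sep f C -> minsep f (opp f C) -> x \notin C ->
  S \subset C -> r (x |: S) = (r S).+1.
Proof.
move=> hC hD xC sSC; have [->|xf] := eqVneq x f; first exact: sep_rkU1 hC sSC.
apply: (minsep_rkU1 hD); first by rewrite !inE negb_or xf.
by rewrite oppK // (sep_notin hC).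
Qed.

(** The two points of [L] in [C] span the third one. *)
Lemma tri_cut C L x : tri L -> x \in L -> x \notin C -> L :\ x \subset C ->
  (forall S, S \subset C -> r (x |: S) = (r S).+1) -> False.
Proof.
move=> /triP[c1 r1] xL xC sL /(_ _ sL); rewrite setD1K // => h.
have := cardsD1 x L; rewrite xL => c2.
by have := @rk_gt1 (L :\ x); lia.
Qed.

Lemma minsep5_cross e A f C : minsep e A -> #|A| = 5 -> cut e A f C ->
  [/\ #|A :&: C| = 2, #|(A :\: C) :\ f| = 2, tri (~: (A :|: C)),
      minsep f (opp f C) & #|opp f C| = 5]
  \/ [/\ #|A :&: C| = 1 & tri ((A :\: C) :\ f)].
Proof.
move=> hA cA [fA hC eC]; have eA := sep_notin (proj1 hA).
have fC := sep_notin hC.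
have [rP cP cN kN] := minsep_cross hA fA hC eC.
have [c3 _ c4] := card_cross eA fC eC fA.
have [N2|N1] : #|A :&: C| = 2 \/ #|A :&: C| = 1 by nat_lia.
  left; have [rW cW hD] := kN N2.
  by split=> //; [nat_lia | apply/triP | nat_lia].
by right; split=> //; apply/triP; split=> //; nat_lia.
Qed.

Section TwoCuts.

Variables (e : T) (A : {set T}) (f g : T) (C C' : {set T}).
Hypotheses (hA : minsep e A) (cA : #|A| = 5).
Hypotheses (cC : cut e A f C) (cC' : cut e A g C').
Hypotheses (N2 : #|A :&: C| = 2) (N2' : #|A :&: C'| = 2).

(** The planes [A] and [opp f C] share two points, so their union has rank at most 4 and [Z], its
    opposite, at least [R - 2]. Hence [e |: Z], which lies in both [C] and [C'], reaches their rank
    [R - 1]. A point of [C'] outside [C] would raise it to [R]. *)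
Lemma cut_sub_of_eq : ~: (A :|: C) = ~: (A :|: C') -> C' \subset C.
Proof.
move=> eqW; have eA := sep_notin (proj1 hA).
have [fA hC eC] := cC; have [gA hC' eC'] := cC'.
have fC := sep_notin hC.
have [[_ P2 tW hD cD]|[]] := minsep5_cross hA cA cC; last by rewrite N2.
have [[_ P2' tW' hD' cD']|[]] := minsep5_cross hA cA cC'; last by rewrite N2'.
have [cW rW] := triP _ tW.
have sWD : ~: (A :|: C) \subset opp f C by rewrite /opp; set_auto.
have rA := minsep5_rk hA cA; have rD := minsep5_rk hD cD.
have rD' := minsep5_rk hD' cD'.
case/sepP: (hC) => _ _ _ rC; case/sepP: (hC') => _ _ _ rC'.
have [c1 c2 c3] := card_cross eA fC eC fA.
have cCge : 5 <= #|C| by rewrite -cA; apply: (proj2 hA) hC.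
set Z := (C :\: A) :\ e in c2.
have eZ : e \notin Z by rewrite !inE eqxx.
have sZB : Z \subset opp e A by rewrite /Z /opp; set_auto.
have rZ : 1 < r Z by apply: rk_gt1; move: c2 N2 cCge; clear; lia.
have rAD : r (A :|: opp f C) <= 4.
  have := @rkUI_sub A (opp f C) (A :|: opp f C) ((A :\: C) :\ f) (subxx _).
  have -> : (A :\: C) :\ f \subset A :&: opp f C by rewrite /opp; set_auto.
  by have := @rk_gt1 ((A :\: C) :\ f); rewrite P2 rA rD => /(_ isT) ? /(_ isT); nat_lia.
have oZ : opp e Z = A :|: opp f C by rewrite /Z /opp; set_auto.
have dc := del_conn2 eZ rZ; rewrite oZ in dc.
have := rkS (subsetUl A (opp f C)) => rA'.
rewrite rA in rA'; have {dc}dc := dc (ltnW rA').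
have rZe := sep_rkU1_opp (proj1 hA) sZB.
apply/negPn/negP => /subsetPn[x xC' xC].
have sZe : e |: Z \subset C.
  by rewrite /Z; set_auto.
have := cut_rkU1 hC hD xC sZe.
have : x |: (e |: Z) \subset C'.
  rewrite subUset sub1set xC' subUset sub1set eC' /=.
  apply/subsetP => z; rewrite !inE => /and3P[ze zA zC]; apply/negPn/negP => zC'.
  have : z \in ~: (A :|: C') by rewrite !inE (negbTE zA).
  by rewrite -eqW !inE zC orbT.
by move/rkS; nat_lia.
Qed.

(** If [d2] of the corner is in [C'] and [d1] is not, then adding [d2] and then [d1] to the triangle
    [~: (A :|: C)] raises the rank twice, although everything lies in the plane [opp f C]. *)
Lemma cut_split : [disjoint ~: (A :|: C) & ~: (A :|: C')] ->
  (A :\: C) :\ f \subset C' \/ [disjoint (A :\: C) :\ f & C'].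
Proof.
move=> dis; have eA := sep_notin (proj1 hA).
have [fA hC eC] := cC; have [gA hC' eC'] := cC'.
have [[_ P2 tW hD cD]|[]] := minsep5_cross hA cA cC; last by rewrite N2.
have [[_ P2' tW' hD' cD']|[]] := minsep5_cross hA cA cC'; last by rewrite N2'.
have [cW rW] := triP _ tW; have rD := minsep5_rk hD cD.
have [|/subsetPn[d1 d1P d1C]] := boolP ((A :\: C) :\ f \subset C'); first by left.
right; rewrite disjoint_sym; apply/pred0P => d2 /=; apply/negbTE/negP => /andP[d2C d2P].
have sW : ~: (A :|: C) \subset C'.
  apply/subsetP => z zW; apply/negPn/negP => zC'.
  have : z \in ~: (A :|: C') by move: zW; rewrite !inE (negbTE zC') orbF negb_or => /andP[].
  by rewrite (disjointFr dis zW).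
have sWB : ~: (A :|: C) \subset opp e A by rewrite /opp; set_auto.
have d2A : d2 \in A by move: d2P; rewrite !inE => /and3P[].
have h1 := minsep_rkU1 hA d2A sWB.
have h2 : r (d1 |: (d2 |: ~: (A :|: C))) = (r (d2 |: ~: (A :|: C))).+1.
  by apply: (cut_rkU1 hC' hD' d1C); rewrite subUset sub1set d2C.
have : d1 |: (d2 |: ~: (A :|: C)) \subset opp f C.
  move: d1P d2P; rewrite !inE => /and3P[d1f d1C0 _] /and3P[d2f d2C0 _].
  by have fd1 : f != d1 by [rewrite eq_sym]; have fd2 : f != d2 by [rewrite eq_sym];
     rewrite /opp; set_auto.
by move/rkS; have := @rk_gt1 (~: (A :|: C)); rewrite cW => /(_ isT); nat_lia.
Qed.

End TwoCuts.

(* The complements of C and C' contain triangles W and W' outside A; these are equal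
   or disjoint, since a side does not span the elements of the other one. *)
Lemma minsep5_two_cuts e A f g C C' : minsep e A -> #|A| = 5 ->
  cut e A f C -> cut e A g C' -> #|A :&: C| = 2 -> #|A :&: C'| = 2 -> f != g ->
  A :\: C = A :\: C' \/ (A :\: C) :\ f = (A :\: C') :\ g.
Proof.
move=> hA cA cC cC' N2 N2' fg; have eA := sep_notin (proj1 hA).
have [fA hC eC] := cC; have [gA hC' eC'] := cC'.
have fC := sep_notin hC; have gC' := sep_notin hC'.
have [[_ P2 tW hD cD]|[]] := minsep5_cross hA cA cC; last by rewrite N2.
have [[_ P2' tW' hD' cD']|[]] := minsep5_cross hA cA cC'; last by rewrite N2'.
have [eqW|neqW] := eqVneq (~: (A :|: C)) (~: (A :|: C')).
  left; congr (A :\: _); apply/eqP; rewrite eqEsubset.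
  by rewrite (cut_sub_of_eq hA cA cC' cC) // (cut_sub_of_eq hA cA cC cC').
have c1 := tri_meet tW tW' neqW.
have sub1 (L D : {set T}) x : tri L -> [disjoint L & A] -> #|L :&: ~: (A :|: D)| <= 1 ->
    x \in L -> x \notin D -> x \notin A -> L :\ x \subset D.
  move=> tL dL cL xL xD xA; apply/subsetP => z; rewrite !inE => /andP[zx zL].
  apply/negPn/negP => zD; move: cL; rewrite leqNgt => /negP; apply.
  apply/card_gt1P; exists z, x; rewrite !inE zL xL !negb_or zD xD xA (disjointFr dL zL).
  by [].
have dis : [disjoint ~: (A :|: C) & ~: (A :|: C')].
  apply/pred0P => x /=; apply/negbTE/negP => /andP[xW xW'].
  have [xA xC'] : x \notin A /\ x \notin C'.
    by move: xW'; rewrite !inE negb_or => /andP[].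
  have s := sub1 _ C' x tW _ c1 xW xC' xA.
  apply: (tri_cut tW xW xC') => [|S sS]; last exact: cut_rkU1 hC' hD' xC' sS.
  by apply: s; apply/pred0P => z /=; rewrite !inE; case: (z \in A); rewrite ?andbF.
have H3 : #|A :\: C| = 3 by have := cardsID C A; nat_lia.
have H3' : #|A :\: C'| = 3 by have := cardsID C' A; nat_lia.
have HH : 0 < #|(A :\: C) :&: (A :\: C')|.
  have := cardsUI (A :\: C) (A :\: C').
  have : #|(A :\: C) :|: (A :\: C')| <= #|A|.
    by apply: subset_leq_card; rewrite subUset !subsetDl.
  by nat_lia.
(* If the corner of [D] lay in [D'], the remaining point [x] of [A :\: D] would be outside [D'],
   because the two triples meet. Then the corner of [D'] contains [x], so it avoids [D] altogether
   and shrinks to [x], although it has two points. *)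
have side (D D' : {set T}) x y : x \notin D -> y \notin D' -> x != y -> x \in A -> y \in A ->
    #|(A :\: D) :\ x| = 2 -> #|(A :\: D') :\ y| = 2 ->
    0 < #|(A :\: D) :&: (A :\: D')| ->
    (A :\: D) :\ x \subset D' ->
    (A :\: D') :\ y \subset D \/ [disjoint (A :\: D') :\ y & D] -> False.
  move=> xD yD' xy xA yA cP cP' hh sP alt.
  have xD' : x \notin D'.
    apply/negP => xD'; case/card_gt0P: hh => z; rewrite !inE => /andP[/andP[zD zA] /andP[zD' _]].
    case/negP: zD'; have [->//|zx] := eqVneq z x.
    by apply: (subsetP sP); rewrite !inE zx zD.
  have xP' : x \in (A :\: D') :\ y by rewrite !inE xy xD'.
  case: alt => [/subsetP/(_ x xP')|dP']; first by rewrite (negbTE xD).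
  have : (A :\: D') :\ y \subset [set x].
    apply/subsetP => z zP'; rewrite inE; apply/negPn/negP => zx.
    move: (zP'); rewrite !inE => /and3P[zy zD' zA]; case/negP: zD'; apply: (subsetP sP).
    by rewrite !inE zx zA (disjointFr dP' zP').
  by move/subset_leq_card; rewrite cards1 cP'.
have a1 := cut_split hA cA cC cC' N2 N2' dis.
rewrite disjoint_sym in dis.
have a2 := cut_split hA cA cC' cC N2' N2 dis.
have gf : g != f by rewrite eq_sym.
case: (a1) => [s1|d1]; first by case: (side C C' f g).
case: (a2) => [s2|d2]; first by case: (side C' C g f); rewrite // setIC.
have k1 : (A :\: C) :\ f \subset A :\: C'.
  by rewrite subsetD d1 andbT; apply: subset_trans (subD1set _ _) (subsetDl _ _).
have k2 : (A :\: C') :\ g \subset A :\: C.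
  by rewrite subsetD d2 andbT; apply: subset_trans (subD1set _ _) (subsetDl _ _).
have [gH|gH] := boolP (g \in A :\: C); [left|right].
  apply/esym/eqP; rewrite eqEcard H3 H3' leqnn andbT.
  have gH' : g \in A :\: C' by rewrite inE gA gC'.
  by rewrite -(setD1K gH') subUset sub1set gH.
apply/eqP; rewrite eqEcard P2 P2' leqnn andbT subsetD1 k1 /=.
by apply: contra gH; apply/subsetP/subD1set.
Qed.

Lemma minsep5_tri_cut e A L f C : minsep e A -> #|A| = 5 -> tri L ->
  (forall L', tri L' -> L' \subset A -> L' = L) -> f \in L -> cut e A f C ->
  #|A :&: C| = 2.
Proof.
move=> hA cA tL uL fL cC; case: (minsep5_cross hA cA cC) => [[]//|[_ tP]].
have sPA : (A :\: C) :\ f \subset A by apply: subset_trans (subD1set _ _) (subsetDl _ _).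
by move: fL; rewrite -(uL _ tP sPA) !inE eqxx.
Qed.

(** If a point [k] of [L] lay in [C], [tri_cut] would give a point [j] of [L :\ f] outside [C]. By
    [minsep5_two_cuts], the cuts at [f] and [j] then share the triple, those at [f] and [k] the
    pair, and those at [j] and [k] can share neither. *)
Lemma minsep5_tri_side e A L f C : minsep e A -> #|A| = 5 -> tri L -> L \subset A ->
  (forall L', tri L' -> L' \subset A -> L' = L) -> f \in L -> cut e A f C ->
  A :\: C = L.
Proof.
move=> hA cA tL sL uL fL cC; have N2 := minsep5_tri_cut hA cA tL uL.
have [cL rL] := triP _ tL; have [fA hC eC] := cC; have fC := sep_notin hC.
apply/eqP; rewrite eq_sym eqEcard cL; apply/andP; split; last first.
  by have := cardsID C A; rewrite (N2 _ _ fL cC); nat_lia.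
apply/negPn/negP => /subsetPn[k kL kH].
have kf : k != f by apply: contraNneq kH => ->; rewrite inE fC.
have [sLC|/subsetPn[j]] := boolP (L :\ f \subset C).
  by apply: (tri_cut tL fL fC sLC) => S; apply: sep_rkU1.
rewrite inE => /andP[jf jL] jC; move: (jf); rewrite inE => {}jf.
have jA := subsetP sL j jL; have kA := subsetP sL k kL.
have [Cj cCj] := minsep_cut hA jA; have [Ck cCk] := minsep_cut hA kA.
have jCj : j \notin Cj by case: cCj => _ /sep_notin.
have kCk : k \notin Ck by case: cCk => _ /sep_notin.
have jk : j != k by apply: contraNneq kH => <-; rewrite inE jC.
have fj : f != j by rewrite eq_sym.
have fk : f != k by rewrite eq_sym.
have t1 := minsep5_two_cuts hA cA cC cCj (N2 _ _ fL cC) (N2 _ _ jL cCj) fj.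
have t2 := minsep5_two_cuts hA cA cC cCk (N2 _ _ fL cC) (N2 _ _ kL cCk) fk.
have t3 := minsep5_two_cuts hA cA cCj cCk (N2 _ _ jL cCj) (N2 _ _ kL cCk) jk.
have jP : j \in (A :\: C) :\ f by rewrite !inE jf jC.
have jPj : j \notin (A :\: Cj) :\ j by rewrite !inE eqxx.
have kHk : k \in A :\: Ck by rewrite inE kCk.
case: t1 => [Hj|Pj]; last by rewrite -Pj jP in jPj.
case: t2 => [Hk|Pk]; first by rewrite Hk kHk in kH.
case: t3 => [Hk|Pk']; first by rewrite Hj Hk kHk in kH.
by rewrite Pk' -Pk jP in jPj.
Qed.

(** The side [opp f C] is again minimum, and consists of its only triangle [W] and of [L :\ f]. Cut
    it at a point [g] of [L :\ f]. If the corner is a pair, comparison with the cuts at the points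
    [t] of [W] makes it equal to [W :\ t] for every [t]. If it is a triangle, it is [W], and [L] has
    only [g] off the new side. *)
Lemma minsep5_not_one_tri e A L : minsep e A -> #|A| = 5 -> tri L -> L \subset A ->
  (forall L', tri L' -> L' \subset A -> L' = L) -> False.
Proof.
move=> hA cA tL sL uL; have [cL rL] := triP _ tL.
have eA := sep_notin (proj1 hA).
have /card_gt0P[f fL] : 0 < #|L| by nat_lia.
have [C cC] := minsep_cut hA (subsetP sL f fL).
have N2 := minsep5_tri_cut hA cA tL uL fL cC.
have HL := minsep5_tri_side hA cA tL sL uL fL cC.
have [fA hC eC] := cC; have fC := sep_notin hC.
have [[_ P2 tW hD cD]|[]] := minsep5_cross hA cA cC; last by rewrite N2.
set W := ~: (A :|: C) in tW; have [cW rW] := triP _ tW.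
have sWD : W \subset opp f C by rewrite /W /opp; set_auto.
have DW : opp f C :\: W = L :\ f by rewrite -HL /W /opp; set_auto.
have cLf : #|L :\ f| = 2 by rewrite -HL.
have uW L' : tri L' -> L' \subset opp f C -> L' = W.
  move=> tL' sL'; apply/eqP/negPn/negP => neq.
  have [cL' _] := triP _ tL'.
  have m1 := tri_meet tL' tW neq.
  have sub : L' :\: W \subset L :\ f by rewrite -DW setSD.
  have m2 : L' != L by apply: contraTneq sL' => ->; apply/subsetPn; exists f; rewrite // !inE eqxx.
  have := tri_meet tL' tL m2; have := cardsID W L'.
  have : #|L' :\: W| <= #|L' :&: L|.
    apply: subset_leq_card; apply/subsetP => z zW; rewrite inE.
    have := subsetP sub z zW; rewrite !inE => /andP[_ ->].
    by move: zW; rewrite inE => /andP[_ ->].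
  by nat_lia.
have /card_gt0P[g gP] : 0 < #|L :\ f| by nat_lia.
have gD : g \in opp f C by move: gP; rewrite -DW inE => /andP[].
have gW : g \notin W by move: gP; rewrite -DW inE => /andP[].
have gL : g \in L by move: gP; rewrite inE => /andP[].
have gf : g != f by move: gP; rewrite !inE => /andP[].
have [C' cC'] := minsep_cut hD gD; have [_ hC' fC'] := cC'.
have gC' := sep_notin hC'.
have [[N2' _ _ _ _]|[_ tP']] := minsep5_cross hD cD cC'.
  have gH : g \in opp f C :\: C' by rewrite inE gC'.
  have allt t : t \in W -> (opp f C :\: C') :\ g = W :\ t.
    move=> tinW; have tD := subsetP sWD t tinW.
    have [Ct cCt] := minsep_cut hD tD.
    have gt : g != t by apply: contraNneq gW => ->.
    have Nt := minsep5_tri_cut hD cD tW uW tinW cCt.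
    have Ht := minsep5_tri_side hD cD tW sWD uW tinW cCt.
    case: (minsep5_two_cuts hD cD cC' cCt N2' Nt gt); rewrite Ht // => E.
    by rewrite E (negbTE gW) in gH.
  have /card_gt1P[t [t' [tinW t'W tt']]] : 1 < #|W| by nat_lia.
  have := allt t' t'W; rewrite (allt t tinW) => /setP/(_ t).
  by rewrite !in_setD1 eqxx tinW tt'.
have EP : (opp f C :\: C') :\ g = W.
  by apply: uW => //; apply: subset_trans (subD1set _ _) (subsetDl _ _).
apply: (tri_cut tL gL gC') => [|S]; last exact: sep_rkU1.
apply/subsetP => z; rewrite !inE => /andP[zg zL].
have [->//|zf] := eqVneq z f.
have : z \in opp f C :\: W by rewrite DW !inE zf.
rewrite inE -EP => /andP[]; rewrite !inE zg /= => z1 z2.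
by move: z1; rewrite z2 andbT negbK.
Qed.

(** The triangles are [f], [h], [g] and [f], [l], [k]; the cut at [f] has the corner [h], [l], and
    the cut at [g] has the corner [L2]. These two cuts are uncrossed with each other, rather than
    with [A]. *)
Lemma minsep5_not_two_tri e A L1 L2 : minsep e A -> #|A| = 5 ->
  tri L1 -> tri L2 -> L1 \subset A -> L2 \subset A -> L1 != L2 -> False.
Proof.
move=> hA cA t1 t2 s1 s2 neq; have eA := sep_notin (proj1 hA).
have [cL1 _] := triP _ t1; have [cL2 _] := triP _ t2.
have m12 := tri_meet t1 t2 neq.
have cU := cardsUI L1 L2.
have sU : L1 :|: L2 \subset A by rewrite subUset s1.
have cUA := subset_leq_card sU.
have eU : L1 :|: L2 = A by apply/eqP; rewrite eqEcard sU; nat_lia.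
have tri_in L' : tri L' -> L' \subset A -> L' != L1 -> L' != L2 -> False.
  move=> t' s' n1 n2; have [c' _] := triP _ t'.
  have := tri_meet t' t1 n1; have := tri_meet t' t2 n2.
  have := cardsUI (L' :&: L1) (L' :&: L2).
  by rewrite -setIUr eU (setIidPl s'); nat_lia.
have /card_gt0P[f] : 0 < #|L1 :&: L2| by nat_lia.
rewrite inE => /andP[f1 f2]; have fA := subsetP s1 f f1.
have [C cC] := minsep_cut hA fA; have [_ hC eC] := cC; have fC := sep_notin hC.
have sP : (A :\: C) :\ f \subset A by apply: subset_trans (subD1set _ _) (subsetDl _ _).
have [[N2 P2 tW hD cD]|[_ tP]] := minsep5_cross hA cA cC; last first.
  have fP : f \notin (A :\: C) :\ f by rewrite !inE eqxx.
  by apply: (tri_in _ tP sP); [apply: contraNneq fP => -> | apply: contraNneq fP => ->].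
have out L : tri L -> f \in L -> exists2 x, x \in L :\ f & x \notin C.
  move=> tL fL; apply/subsetPn; apply/negP => sLC.
  by apply: (tri_cut tL fL fC sLC) => S; apply: sep_rkU1.
have [h h1 hCn] := out _ t1 f1; have [l l2 lCn] := out _ t2 f2.
move: h1 l2; rewrite !inE => /andP[hf h1] /andP[lf l2].
have only x : x \in L1 -> x \in L2 -> x = f.
  move=> x1 x2; apply/eqP/negPn/negP => xf; move: m12; rewrite leqNgt => /negP; apply.
  by apply/card_gt1P; exists x, f; rewrite !inE x1 x2 f1 f2.
have hl : h != l by apply: contraNneq hf => E; rewrite (only h) // E.
have [hA' lA'] : h \in A /\ l \in A by rewrite (subsetP s1) ?(subsetP s2).
have PE : (A :\: C) :\ f = [set h; l].
  apply/esym/eqP; rewrite eqEcard cards2 hl P2 leqnn andbT.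
  by apply/subsetP => z; rewrite !inE => /orP[]/eqP->; rewrite ?hf ?lf ?hCn ?lCn.
have rest L x : L \subset A -> tri L -> f \in L -> x \in L -> x != f ->
    [set h; l] :&: L = [set x] -> exists g, [/\ g \in L, g != f, g != x, g \in C & g \in A].
  move=> sL tL fL xL xf EL; have [cL _] := triP _ tL.
  have /card_gt0P[g] : 0 < #|L :\ f :\ x|.
    have := cardsD1 f L; have := cardsD1 x (L :\ f).
    by rewrite fL !inE xL xf; nat_lia.
  rewrite !inE => /and3P[gx gf gL]; exists g; split=> //; last exact: (subsetP sL).
  apply/negPn/negP => gC; have : g \in [set h; l] :&: L.
    by rewrite -PE !inE gf gC gL (subsetP sL).
  by rewrite EL inE (negbTE gx).
have hL2 : h \notin L2 by apply/negP => h2; rewrite (only h) ?eqxx in hf.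
have lL1 : l \notin L1 by apply/negP => l1; rewrite (only l) ?eqxx in lf.
have [g [g1 gf gh gC gA]] : exists g, [/\ g \in L1, g != f, g != h, g \in C & g \in A].
  apply: (rest L1 h s1 t1 f1 h1 hf); apply/setP => z; rewrite !inE.
  by case: (eqVneq z h) => [->|_] /=; rewrite ?h1 //; case: eqP => [->|//]; rewrite (negbTE lL1).
have [k [k2 kf kl kC kA]] : exists g, [/\ g \in L2, g != f, g != l, g \in C & g \in A].
  apply: (rest L2 l s2 t2 f2 l2 lf); apply/setP => z; rewrite !inE.
  by case: (eqVneq z l) => [->|_] /=; rewrite ?l2 ?orbT // orbF; case: eqP => [->|//]; rewrite (negbTE hL2).
have gk : g != k by apply: contraNneq gf => E; rewrite (only g) // E.
have gl : g != l by apply: contraNneq lCn => <-.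
have L2E : L2 = f |: [set k; l].
  apply/esym/eqP; rewrite eqEcard cL2 cardsU1 cards2 kl !inE ![f == _]eq_sym (negbTE lf).
  rewrite (negbTE kf) andbT; apply/subsetP => z; rewrite !inE.
  by case/or3P => /eqP->.
have [C' cC'] := minsep_cut hA gA; have [_ hC' eC'] := cC'; have gC' := sep_notin hC'.
have gL2 : g \notin L2 by apply/negP => g2; rewrite (only g) ?eqxx in gf.
have sP' : (A :\: C') :\ g \subset A by apply: subset_trans (subD1set _ _) (subsetDl _ _).
have [[N2' _ _ hD' _]|[_ tP']] := minsep5_cross hA cA cC'.
  have fg : f != g by rewrite eq_sym.
  case: (minsep5_two_cuts hA cA cC cC' N2 N2' fg) => [/setP/(_ g)|PP'].
    by rewrite !inE gC gC' gA.
  have lP' : l \in (A :\: C') :\ g by rewrite -PP' PE !inE eqxx orbT.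
  have lC' : l \notin C' by move: lP'; rewrite !inE => /and3P[].
  apply: (tri_cut t2 l2 lC') => [|S]; last exact: (cut_rkU1 hC' hD' lC').
  apply/subsetP => z; rewrite !inE => /andP[zl z2]; apply/negPn/negP => zC'.
  have : z \in (A :\: C') :\ g.
    have zg : z != g by apply: contraNneq gL2 => <-.
    by rewrite !inE zC' zg (subsetP s2 z z2).
  by rewrite -PP' PE !inE (negbTE zl) orbF => /eqP zh; rewrite -zh z2 in hL2.
have EP' : (A :\: C') :\ g = L2.
  apply/eqP/negPn/negP => n2; apply: (tri_in _ tP' sP' _ n2).
  by apply: contraTneq g1 => <-; rewrite !inE eqxx.
have inP' z : z \in L2 -> z \notin C' by rewrite -EP' !inE => /and3P[].
have hg : h != g by rewrite eq_sym.
have hC1 : h \in C' by move: hL2; rewrite -EP' !inE hA' hg andbT negbK.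
have [fC' lC' kC'] : [/\ f \notin C', l \notin C' & k \notin C'] by split; apply: inP'.
have fg : f != g by rewrite eq_sym.
have lg : l != g by rewrite eq_sym.
have kg : k != g by rewrite eq_sym.
have eg : e != g by apply: contraNneq eA => ->.
have ef : e != f by apply: contraNneq eA => ->.
set W := ~: (A :|: C) in tW; have [cW _] := triP _ tW.
have hD'0 := sep_opp hC'; set D' := opp g C' in hD'0.
have fD' : f \in D' by rewrite !inE negb_or fg.
have us := uncross_side hC hD'0 fD' gC; have uc := uncross_cross hC hD'0 fD' gC.
set X1 := (C :\: D') :\ g in uc; set X2 := (D' :\: C) :\ f in uc.
set V := C :&: D' in us; set Y := ~: (C :|: D') in us.
have sWB : W \subset opp e A by rewrite /W /opp; set_auto.
have cWC := cardsID C' W.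
have cC'5 : 5 <= #|C'| by rewrite -cA; apply: (proj2 hA) hC'.
have cD'5 : 5 <= #|D'| by rewrite -cA; apply: (proj2 hA) hD'0.
have HE : A :\: C = f |: [set h; l].
  by rewrite -PE setD1K // inE fC.
have inH z : z \in A -> z \notin C -> [|| z == f, z == h | z == l].
  by move=> zA zC; have : z \in A :\: C; [rewrite inE zC | rewrite HE !inE].
(* Two of the three points of [W] lie on the same side of [C']. If outside, they and [l] give [X2]
   rank 3, while [X2] is smaller than [A]; so [X1] has at most one element, which makes [C'] too
   small. *)
have [w1|w1] := ltnP 1 #|W :\: C'|.
  have s3 : l |: (W :\: C') \subset X2.
    rewrite subUset sub1set !inE lf lCn (negbTE lg) lC' /=.
    apply/subsetP => z; rewrite !inE !negb_or => /andP[zC' /andP[zA zC]].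
    rewrite zC zC' !andbT; apply/andP; split; first by apply: contraNneq zA => ->.
    by apply: contraNneq zA => ->.
  have r2 : 2 < r X2.
    apply: leq_trans (rkS s3); rewrite (minsep_rkU1 hA lA').
      by rewrite ltnS; apply: rk_gt1.
    by apply: subset_trans sWB; apply: subsetDl.
  have sX2 : X2 \subset opp f C :\ h.
    apply/subsetP => z; rewrite !inE !negb_or => /and3P[zf zC /andP[zg zC']].
    by rewrite zf zC !andbT; apply: contraNneq zC' => ->.
  have fX2 : f \notin X2 by rewrite !inE eqxx.
  have cX2 : #|X2| < #|A|.
    have := subset_leq_card sX2; have := cardsD1 h (opp f C).
    by rewrite !inE negb_or hf hCn cD /=; nat_lia.
  have sC : C \subset opp f X2 by rewrite /X2 /D' /opp; set_auto.
  case/sepP: (hC) => _ rC _ _.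
  have b1 := minsep_sub hA fX2 cX2 r2 (leq_trans rC (rkS sC)).
  have gX1 : g \notin X1 by rewrite !inE eqxx.
  have sD' : D' \subset opp g X1 by rewrite /X1 /D' /opp; set_auto.
  case/sepP: (hD'0) => _ rD' _ _.
  have [x1|x1] := ltnP 1 #|X1|.
    have := del_conn2 gX1 (rk_gt1 x1) (ltnW (leq_trans rD' (rkS sD'))).
    by nat_lia.
  have s4 : C' \subset X1 :|: (h |: (W :&: C')).
    apply/subsetP => z zC'; rewrite !in_setU !in_set1 !in_setI zC' andbT.
    have zg : z != g by apply: contraNneq gC' => <-.
    have [zC|zC] := boolP (z \in C); first by rewrite !inE zg zC zC' orbT.
    have [zA|zA] := boolP (z \in A); last by rewrite !inE (negbTE zA) zC !orbT.
    case/or3P: (inH z zA zC) => /eqP E; first by rewrite -E zC' in fC'.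
      by rewrite E eqxx orbT.
    by rewrite -E zC' in lC'.
  have := subset_leq_card s4; have := cardsUI X1 (h |: (W :&: C')).
  have := cardsU1 h (W :&: C'); case: (_ \notin _) => /=; nat_lia.
have {w1}w1 : 1 < #|W :&: C'| by nat_lia.
(* With [Y] of rank at least 3, at most [R + 1] is left for [V]. Then [V] is a side for [g], and its
   opposite contains the three points of [A :\: C], one more than [minsep_cross] allows. *)
have sY : h |: (W :&: C') \subset Y by rewrite /Y /W /D' /opp; set_auto.
have rY : 2 < r Y.
  apply: leq_trans (rkS sY); rewrite (minsep_rkU1 hA hA').
    by rewrite ltnS; apply: rk_gt1.
  by apply: subset_trans sWB; apply: subsetIl.
case/sepP: (hC) => _ rC _ _; case/sepP: (hC') => _ rC' _ _.
have b1 := conn3 (leq_trans rC (rkS (subsetUl C D'))) rY; rewrite -/Y in b1.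
have gV : g \notin V by rewrite !inE eqxx andbF.
have sC'V : C' \subset opp g V by rewrite /V /D' /opp; set_auto.
have kV : k \in V by rewrite !inE kC (negbTE kg) kC'.
have s5 : D' \subset V :|: [set f; l] :|: (W :\: C').
  apply/subsetP => z zD'; rewrite !in_setU in_setI zD' andbT.
  have [//|zC] := boolP (z \in C).
  move: zD'; rewrite !inE negb_or => /andP[zg zC'].
  have [zA|zA] := boolP (z \in A); last by rewrite zC' zC !orbT.
  case/or3P: (inH z zA zC) => /eqP E; rewrite ?E ?eqxx ?orbT //.
  by rewrite E hC1 in zC'.
have cV : 1 < #|V|.
  have := subset_leq_card s5; have := cardsUI (V :|: [set f; l]) (W :\: C').
  have := cardsUI V [set f; l]; have := cards2 f l.
  by case: (_ != _) => /=; nat_lia.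
have [cV2|cV2] := leqP #|V| 2.
  have := rk_gt1 cV; have := @small4 (f |: (g |: V)).
  rewrite !cardsU1; case: (_ \notin _); case: (_ \notin _) => /= s; rewrite s in us; nat_lia.
have sVB : V :\ k \subset opp e A.
  apply/subsetP => z; rewrite !inE !negb_or => /and4P[zk zC zg zC'].
  apply/andP; split; first by apply: contraNneq zC' => ->.
  apply/negP => zA; have : z \in L2 by rewrite -EP' !inE zg zC'.
  rewrite L2E !inE (negbTE zk) /= => /orP[]/eqP E; first by rewrite -E zC in fC.
  by rewrite -E zC in lCn.
have rV : 2 < r V.
  have := minsep_rkU1 hA kA sVB; rewrite setD1K // => ->; rewrite ltnS.
  by apply: rk_gt1; have := cardsD1 k V; rewrite kV; nat_lia.
have rVo := leq_trans rC' (rkS sC'V).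
have b2 := del_conn2 gV (ltnW rV) (ltnW rVo).
have s6 : opp g V \subset f |: ~: (f |: (g |: V)) by rewrite /opp; set_auto.
have b3 := rkS s6; have b4 := rkU1 f (~: (f |: (g |: V))).
have sV : sep g V by apply/sepP; split=> //; nat_lia.
have eo : e \in opp g V by rewrite (subsetP sC'V).
have [_ _ cN _] := minsep_cross hA gA (sep_opp sV) eo.
have : A :\: C \subset A :&: opp g V.
  apply/subsetP => z; rewrite !inE => /andP[zC zA]; rewrite zA (negbTE zC) orbF /=.
  by apply: contraNneq zC => ->.
by move/subset_leq_card; have := cardsID C A; nat_lia.
Qed.

(** Any cut produces a triangle inside a five-element minimum side, namely [A] or [opp f C]. *)
Lemma minsep_card_neq5 e A : minsep e A -> #|A| = 5 -> False.
Proof.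
move=> hA cA.
have key e' A' L : minsep e' A' -> #|A'| = 5 -> tri L -> L \subset A' -> False.
  move=> hA' cA' tL sL; apply: (minsep5_not_one_tri hA' cA' tL sL) => L' tL' sL'.
  by apply/eqP/negPn/negP => /(minsep5_not_two_tri hA' cA' tL' tL sL' sL).
have /card_gt0P[f fA] : 0 < #|A| by nat_lia.
have [C cC] := minsep_cut hA fA; have [_ hC eC] := cC.
have [[_ _ tW hD cD]|[_ tP]] := minsep5_cross hA cA cC.
  by apply: key hD cD tW _; rewrite /opp; set_auto.
by apply: key hA cA tP _; apply: subset_trans (subD1set _ _) (subsetDl _ _).
Qed.

(** * Minimum sides with four elements *)

Lemma minsep4_tri e A L : minsep e A -> #|A| = 4 -> L \subset A -> 2 < #|L| -> 2 < r L.
Proof.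
move=> hA cA sL cL; rewrite ltnNge; apply/negP => rL.
have := minsep_coline hA sL rL; have := cardsID L A.
by rewrite (setIidPr sL); nat_lia.
Qed.

Lemma minsep4_rk e A : minsep e A -> #|A| = 4 -> r A = 3.
Proof.
move=> hA cA; have /card_gt1P[x [y [xA yA xy]]] : 1 < #|A| by rewrite cA.
have sA : [set x; y] \subset A by rewrite subUset !sub1set xA.
apply: (minsep_plane hA sA); first by rewrite rk2.
by have := cardsID [set x; y] A; rewrite (setIidPr sA) cards2 xy cA; nat_lia.
Qed.

(** A four-element minimum side has no three collinear points. This bounds the corner, and it
    excludes [#|A :&: C| = 2], where [opp f C] would contain a triangle. *)
Lemma minsep4_cross e A f C : minsep e A -> #|A| = 4 -> cut e A f C ->
  #|A :&: C| = 1 /\ #|(A :\: C) :\ f| = 2.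
Proof.
move=> hA cA [fA hC eC]; have eA := sep_notin (proj1 hA).
have fC := sep_notin hC.
have [rP cP cN kN] := minsep_cross hA fA hC eC.
have [c3 _ c4] := card_cross eA fC eC fA.
have P2 : #|(A :\: C) :\ f| <= 2.
  rewrite leqNgt; apply/negP => P3; have := minsep4_tri hA cA _ P3.
  have -> : (A :\: C) :\ f \subset A by set_auto.
  by move/(_ isT); rewrite ltnNge rP.
have [N2|N1] : #|A :&: C| = 2 \/ #|A :&: C| = 1 by nat_lia.
  have [rW cW hD] := kN N2.
  have cD : #|opp f C| = 4 by nat_lia.
  have := minsep4_tri hD cD (L := ~: (A :|: C)); rewrite cW.
  have -> : ~: (A :|: C) \subset opp f C by rewrite /opp; set_auto.
  by move/(_ isT isT); rewrite ltnNge rW.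
by split=> //; nat_lia.
Qed.

(** By [minsep4_cross], a separation for [f] has two of the four points of [(e |: A) :\ f] on each
    side, but [x |: S] contains only [x]. *)
Lemma minsep4_nosep e A f x S : minsep e A -> #|A| = 4 -> f \in A ->
  x \in e |: A -> x != f -> S \subset opp e A ->
  2 < r (x |: S) -> 2 < r (opp f (x |: S)) ->
  R + 3 <= r (x |: S) + r (opp f (x |: S)).
Proof.
move=> hA cA fA xK xf sS h1 h2; have eA := sep_notin (proj1 hA).
have ef : e != f by apply: contraNneq eA => ->.
have [fB eB] : f \notin opp e A /\ e \notin opp e A.
  by rewrite !inE eqxx fA orbT.
have fS : f \notin S by apply: contra fB; apply/subsetP.
have eS : e \notin S by apply: contra eB; apply/subsetP.
have AS z : z \in A -> z \notin S.
  by move=> zA; apply/negP => /(subsetP sS); rewrite !inE zA orbT.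
have fxS : f \notin x |: S by rewrite !inE negb_or eq_sym xf.
have h3 := del_conn2 fxS (ltnW h1) (ltnW h2).
rewrite leqNgt; apply/negP => h4.
have hS : sep f (x |: S) by apply/sepP; split=> //; nat_lia.
move: xK; rewrite !inE => /orP[/eqP xe|xA].
  have [] := minsep4_cross hA cA (And3 fA hS _); first by rewrite xe !inE eqxx.
  suff -> : A :&: (x |: S) = set0 by rewrite cards0.
  apply/setP => z; rewrite !inE xe; case: (eqVneq z e) => [->|_] /=.
    by rewrite (negbTE eA).
  by case zA : (z \in A) => //=; apply/negbTE/AS.
have eo : e \in opp f (x |: S).
  rewrite !inE (negbTE ef) (negbTE eS) orbF /=.
  by apply: contraNneq eA => ->.
have [_] := minsep4_cross hA cA (And3 fA (sep_opp hS) eo).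
suff -> : (A :\: opp f (x |: S)) :\ f = [set x] by rewrite cards1.
apply/setP => z; rewrite !inE; case: (eqVneq z x) => [->|zx] /=.
  by rewrite xf orbT xA.
case: (eqVneq z f) => //= zf; rewrite negbK.
by case zA : (z \in A); rewrite ?andbF // andbT; apply/negbTE/AS.
Qed.

(** If [S] has rank at least 3, [conn3] gives [R + 3], and removing [f] and [g] from its complement
    costs only one unit because [A :\ f] spans [f]. *)
Lemma minsep4_quad e A f g S : minsep e A -> #|A| = 4 -> f \in A -> g \in A ->
  f != g -> S \subset opp e A -> 1 < #|S| ->
  R + 2 <= r S + r (~: (f |: (g |: S))).
Proof.
move=> hA cA fA gA fg sS cS.
have [rS|rS] := leqP (r S) 2.
  have := @small (f |: (g |: S)) S; rewrite setUA subsetUr => /(_ isT rS) ->.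
    by have := rk_gt1 cS; nat_lia.
  apply: leq_trans (subset_leq_card (_ : _ \subset [set f; g])) _.
    by set_auto.
  by rewrite cards2 fg.
have sA : A \subset ~: S.
  apply/subsetP => z zA; rewrite inE; apply/negP => /(subsetP sS).
  by rewrite !inE zA orbT.
have rA := minsep4_rk hA cA.
have m := rkS sA; rewrite rA in m.
have c := conn3 rS m.
have rAf : 2 < r (A :\ f).
  by apply: (minsep4_tri hA cA (subD1set _ _)); have := cardsD1 f A; rewrite fA; nat_lia.
have := @rkUI_sub (g |: ~: (f |: (g |: S))) A (~: S) (A :\ f).
have -> : ~: S \subset g |: ~: (f |: (g |: S)) :|: A.
  by set_auto.
have -> : A :\ f \subset (g |: ~: (f |: (g |: S))) :&: A.
  rewrite subsetI subD1set andbT; apply/subsetP => z; rewrite !inE => /andP[zf zA].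
  have : z \in ~: S by apply: (subsetP sA).
  by rewrite !inE (negbTE zf) => /negbTE ->; case: (z == g).
move=> /(_ isT isT); have := rkU1 g (~: (f |: (g |: S))).
by nat_lia.
Qed.

(** Here [r S <= R - 3], so [conn3] and [r (~: S) <= 5] force [r S <= 2]. Then [small] gives [W]
    full rank, so [R = 4] and [S] is a single point. *)
Lemma nine_points S z W : 0 < #|S| -> #|~: S| = 8 -> r (~: S) <= 5 ->
  r (z |: S) = (r S).+1 -> r (z |: S) + 2 <= R ->
  S \subset ~: W -> #|(~: W) :\: S| <= 2 -> r W <= 4 -> R = 4 /\ #|T| = 9.
Proof.
move=> S0 cS' rS' zS rzS sS cW rW.
have r8 : 2 < r (~: S) by apply: rk_gt2; rewrite cS'.
have rS : r S <= 2.
  by rewrite leqNgt; apply/negP => rS; have := conn3 rS r8; nat_lia.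
have := small sS rS cW; rewrite setCK => R4.
have cT := cardsC S.
have [S1|S1] := ltnP 1 #|S|; first by have := rk_gt1 S1; nat_lia.
by split; nat_lia.
Qed.

Lemma quadrant_sizes (q1 q2 q3 q4 : nat) : 2 <= q2 + q3 -> 2 <= q2 + q4 ->
  2 <= q1 + q4 -> 2 <= q1 + q3 -> (1 < q1 -> 1 < q2 -> False) ->
  (1 < q3 -> q4 = 0) -> (1 < q4 -> q3 = 0) ->
  [/\ q3 = 1, q4 = 1 & (q1 = 1 /\ 0 < q2) \/ (q2 = 1 /\ 0 < q1)].
Proof.
move=> h1 h2 h3 h4 h12 h34 h43.
have {}h12 : q1 <= 1 \/ q2 <= 1.
  have [?|g1] := leqP q1 1; [by left | right].
  by rewrite leqNgt; apply/negP => /(h12 g1).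
have c3 : q3 <= 1 by rewrite leqNgt; apply/negP => /h34; lia.
have c4 : q4 <= 1 by rewrite leqNgt; apply/negP => /h43; lia.
clear h34 h43; split; lia.
Qed.

(* X and Y are sides of separations for a and b.  They cut e |: A into
   {q, b} | {p, s} and {s, a} | {p, q}, and the rest of the matroid into the four
   quadrants Q1, ..., Q4, of which only Q1 or Q2 can have more than one element. *)
Section FourPointSide.

Variables (e a b p q s : T) (A X Y : {set T}).
Hypotheses (hA : minsep e A) (cA : #|A| = 4).
Hypotheses (K5 : e |: A = [set a; b; p; q; s]) (es : e = p \/ e = q).
Hypotheses (aA : a \in A) (bA : b \in A).
Hypotheses (hX : sep a X) (hY : sep b Y).
Hypotheses (qX : q \in X) (bX : b \in X) (pX : p \notin X) (sX : s \notin X).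
Hypotheses (sY : s \in Y) (aY : a \in Y) (pY : p \notin Y) (qY : q \notin Y).

Let aX : a \notin X. Proof. exact: sep_notin hX. Qed.
Let bY : b \notin Y. Proof. exact: sep_notin hY. Qed.
Let eA : e \notin A. Proof. exact: sep_notin (proj1 hA). Qed.

Let distinct : [/\ [/\ a != b, a != p, a != q & a != s],
  [/\ b != p, b != q & b != s], p != q /\ p != s & q != s].
Proof.
have := cardsU1 e A; rewrite eA cA K5 => c5.
have : uniq [:: a; b; p; q; s].
  apply/card_uniqP; rewrite /= -[5]/(true + 4) -c5.
  by apply: eq_card => z; rewrite !inE -!orbA.
rewrite /= !inE !negb_or => /and5P[/and4P[-> -> -> ->] /and3P[-> -> ->] /andP[-> ->] -> _].
by split.
Qed.

Let B := ~: [set a; b; p; q; s].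
Let Q1 := B :\: (X :|: Y).
Let Q2 := B :&: (X :&: Y).
Let Q3 := B :&: (X :\: Y).
Let Q4 := B :&: (Y :\: X).

Let oppA : opp e A = B. Proof. by rewrite /opp K5. Qed.

Let inK z : z \in [set a; b; p; q; s] -> z \in e |: A. Proof. by rewrite K5. Qed.

Let XE : X = [set q; b] :|: (Q2 :|: Q3).
Proof. have [[ab ap aq as_] [bp bq bs] [pq ps] qs] := distinct; rewrite /Q2 /Q3 /B; set_auto. Qed.

Let YE : Y = [set s; a] :|: (Q2 :|: Q4).
Proof. have [[ab ap aq as_] [bp bq bs] [pq ps] qs] := distinct; rewrite /Q2 /Q4 /B; set_auto. Qed.

Let oXE : opp a X = [set p; s] :|: (Q1 :|: Q4).
Proof. have [[ab ap aq as_] [bp bq bs] [pq ps] qs] := distinct; rewrite /opp /Q1 /Q4 /B; set_auto. Qed.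

Let oYE : opp b Y = [set p; q] :|: (Q1 :|: Q3).
Proof. have [[ab ap aq as_] [bp bq bs] [pq ps] qs] := distinct; rewrite /opp /Q1 /Q3 /B; set_auto. Qed.

Let rkK x S : x \in [set a; b; p; q; s] -> S \subset B -> r (x |: S) = (r S).+1.
Proof.
rewrite -K5 -oppA !inE => /orP[/eqP->|xA] sS; last exact: minsep_rkU1 hA xA sS.
exact: sep_rkU1_opp (proj1 hA) sS.
Qed.

Let rXY : [/\ 2 < r X, 2 < r (opp a X), 2 < r Y & 2 < r (opp b Y)].
Proof. by case/sepP: hX => _ ? ? _; case/sepP: hY. Qed.

Let sides : [/\ 2 <= #|Q2| + #|Q3|, 2 <= #|Q2| + #|Q4|, 2 <= #|Q1| + #|Q4|
  & 2 <= #|Q1| + #|Q3|].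
Proof.
have [_ m] := hA.
have m1 := m _ _ hX; have m2 := m _ _ (sep_opp hX).
have m3 := m _ _ hY; have m4 := m _ _ (sep_opp hY).
have u x y S S' : #|[set x; y] :|: (S :|: S')| <= 2 + (#|S| + #|S'|).
  apply: leq_trans (leq_card_setU _ _) _; apply: leq_add; last exact: leq_card_setU.
  by rewrite cards2; case: (_ != _).
rewrite cA XE in m1; rewrite cA oXE in m2; rewrite cA YE in m3; rewrite cA oYE in m4.
have := leq_trans m1 (u _ _ _ _); have := leq_trans m2 (u _ _ _ _).
have := leq_trans m3 (u _ _ _ _); have := leq_trans m4 (u _ _ _ _).
by split; nat_lia.
Qed.

(** [X :|: Y] costs [R + 3], as its complement is [p |: Q1], and [Q2] costs [R + 2] by
    [minsep4_quad]. *)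
Let Q12 : 1 < #|Q1| -> 1 < #|Q2| -> False.
Proof.
move=> q1 q2; have [[ab ap aq as_] [bp bq bs] [pq ps] qs] := distinct.
have us := uncross_side hX hY aY bX.
have [rX _ _ _] := rXY.
have E1 : ~: (X :|: Y) = p |: Q1 by rewrite /Q1 /B; set_auto.
have E2 : X :&: Y = Q2 by rewrite /Q2 /B; set_auto.
have r1 : 2 < r (~: (X :|: Y)).
  rewrite E1 rkK ?subsetDl // ?inE ?eqxx ?orbT // ltnS.
  exact: rk_gt1.
have c1 := conn3 (leq_trans rX (rkS (subsetUl X Y))) r1.
have sQ2 : Q2 \subset opp e A by rewrite oppA subsetIl.
have := minsep4_quad hA cA aA bA ab sQ2 q2.
by rewrite E2 in us; nat_lia.
Qed.

(** The corners are [q |: Q3], which costs [R + 3] by [minsep4_nosep], and [s |: Q4], which costs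
    [R + 2] as soon as [Q4] has an element. *)
Let Q34 : 1 < #|Q3| -> #|Q4| = 0.
Proof.
move=> q3; have [[ab ap aq as_] [bp bq bs] [pq ps] qs] := distinct.
have uc := uncross_cross hX hY aY bX; have [rX _ rY _] := rXY.
have E3 : (X :\: Y) :\ b = q |: Q3 by rewrite /Q3 /B; set_auto.
have E4 : (Y :\: X) :\ a = s |: Q4 by rewrite /Q4 /B; set_auto.
rewrite E3 E4 in uc.
have qK : q \in [set a; b; p; q; s] by rewrite !inE eqxx !orbT.
have sK : s \in [set a; b; p; q; s] by rewrite !inE eqxx !orbT.
have [sQ3 sQ4] : Q3 \subset B /\ Q4 \subset B by rewrite !subsetIl.
have s3 : Y \subset opp b (q |: Q3) by rewrite /Q3 /opp; set_auto.
have s4 : X \subset opp a (s |: Q4) by rewrite /Q4 /opp; set_auto.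
have n3 : R + 3 <= r (q |: Q3) + r (opp b (q |: Q3)).
  apply: (minsep4_nosep hA cA bA); rewrite ?inK // 1?eq_sym ?oppA //.
    by rewrite rkK // ltnS; apply: rk_gt1.
  by apply: leq_trans rY (rkS s3).
apply/eqP; rewrite -leqn0 leqNgt; apply/negP => q4.
have as4 : a \notin s |: Q4 by rewrite in_setU1 (negbTE as_); apply/negP => /(subsetP sQ4); rewrite !inE eqxx.
have := del_conn2 as4; rewrite (rkK sK sQ4) ltnS rk_gt0 // => /(_ isT).
by move/(_ (ltnW (leq_trans rX (rkS s4)))); rewrite (rkK sK sQ4) in uc; nat_lia.
Qed.

Let Q43 : 1 < #|Q4| -> #|Q3| = 0.
Proof.
move=> q4; have [[ab ap aq as_] [bp bq bs] [pq ps] qs] := distinct.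
have uc := uncross_cross hX hY aY bX; have [rX _ rY _] := rXY.
have E3 : (X :\: Y) :\ b = q |: Q3 by rewrite /Q3 /B; set_auto.
have E4 : (Y :\: X) :\ a = s |: Q4 by rewrite /Q4 /B; set_auto.
rewrite E3 E4 in uc.
have qK : q \in [set a; b; p; q; s] by rewrite !inE eqxx !orbT.
have sK : s \in [set a; b; p; q; s] by rewrite !inE eqxx !orbT.
have [sQ3 sQ4] : Q3 \subset B /\ Q4 \subset B by rewrite !subsetIl.
have s3 : Y \subset opp b (q |: Q3) by rewrite /Q3 /opp; set_auto.
have s4 : X \subset opp a (s |: Q4) by rewrite /Q4 /opp; set_auto.
have n4 : R + 3 <= r (s |: Q4) + r (opp a (s |: Q4)).
  apply: (minsep4_nosep hA cA aA); rewrite ?inK // 1?eq_sym ?oppA //.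
    by rewrite rkK // ltnS; apply: rk_gt1.
  by apply: leq_trans rX (rkS s4).
apply/eqP; rewrite -leqn0 leqNgt; apply/negP => q3.
have bq3 : b \notin q |: Q3 by rewrite in_setU1 (negbTE bq); apply/negP => /(subsetP sQ3); rewrite !inE eqxx !orbT.
have := del_conn2 bq3; rewrite (rkK qK sQ3) ltnS rk_gt0 // => /(_ isT).
by move/(_ (ltnW (leq_trans rY (rkS s3)))); rewrite (rkK qK sQ3) in uc; nat_lia.
Qed.

Let minsep_card4 f D : sep f D -> #|D| = 4 -> minsep f D.
Proof. by move=> hD cD; split=> // g Z /(proj2 hA); rewrite cA cD. Qed.

Let rk_three f D x y z : minsep f D -> #|D| = 4 -> x != y -> x != z -> y != z ->
  x \in D -> y \in D -> z \in D -> 2 < r [set x; y; z].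
Proof.
move=> hD cD xy xz yz xD yD zD; apply: (minsep4_tri hD cD).
  by rewrite !subUset !sub1set xD yD.
by rewrite -setUA cardsU1 cards2 yz !inE negb_or xy xz.
Qed.

Let cardT : #|T| = 5 + (#|Q1| + #|Q2| + #|Q3| + #|Q4|).
Proof.
have := cardsC [set a; b; p; q; s]; rewrite -/B.
have -> : #|[set a; b; p; q; s]| = 5 by rewrite -K5 cardsU1 eA cA.
have := cardsID X B; have := cardsID Y (B :&: X); have := cardsID Y (B :\: X).
have -> : (B :&: X) :&: Y = Q2 by rewrite /Q2; set_auto.
have -> : (B :&: X) :\: Y = Q3 by rewrite /Q3; set_auto.
have -> : (B :\: X) :&: Y = Q4 by rewrite /Q4; set_auto.
have -> : (B :\: X) :\: Y = Q1 by rewrite /Q1; set_auto.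
by nat_lia.
Qed.

(** The set [w |: (e |: A)] has rank at most 5 and spans both planes [Z1] and [Z2]. *)
Let span w Z1 Z2 S : r Z1 = 3 -> r Z2 = 3 ->
  (exists S1, [/\ S1 \subset (w |: (e |: A)) :&: Z1 & 2 < r S1]) ->
  (exists S2, [/\ S2 \subset (w |: (e |: A)) :&: Z2 & 2 < r S2]) ->
  S \subset (w |: (e |: A)) :|: Z1 :|: Z2 -> r S <= 5.
Proof.
move=> r1 r2 [S1 [s1 k1]] [S2 [s2 k2]] sS.
have := rkU1 w (e |: A); have := rkU1 e A; rewrite (minsep4_rk hA cA).
have := rkUI_sub (subxx (w |: (e |: A) :|: Z1)) s1.
have s2' : S2 \subset (w |: (e |: A) :|: Z1) :&: Z2.
  by apply: subset_trans s2 _; apply: setSI; apply: subsetUl.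
have := rkUI_sub (subxx _) s2'; have := rkS sS.
by nat_lia.
Qed.

Lemma four_point_side_nine : R = 4 /\ #|T| = 9.
Proof.
have [[ab ap aq as_] [bp bq bs] [pq ps] qs] := distinct.
have [v1 v2 v3 v4] := sides.
have [c3 c4 c12] := quadrant_sizes v1 v2 v3 v4 Q12 Q34 Q43.
have /cards1P[z Ez] : #|Q3| == 1 by rewrite c3.
have zQ : z \in Q3 by rewrite Ez set11.
have [zB [zX zY]] : z \in B /\ z \in X /\ z \notin Y.
  by move: zQ; rewrite in_setI in_setD => /and3P[].
have cards_le x y S S' : #|[set x; y] :|: (S :|: S')| <= 2 + (#|S| + #|S'|).
  apply: leq_trans (leq_card_setU _ _) _; apply: leq_add; last exact: leq_card_setU.
  by rewrite cards2; case: (_ != _).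
have [_ m] := hA; rewrite cA in m.
have [sB1 sB2] : Q1 \subset B /\ Q2 \subset B by rewrite subsetDl subsetIl.
have zK x : x \in [set a; b; p; q; s] -> z != x.
  by move=> xK; apply: contraTneq zB => ->; rewrite inE xK.
case: c12 => [[c1 c2]|[c2 c1]].
- have /cards1P[w Ew] : #|Q1| == 1 by rewrite c1.
  have wQ : w \in Q1 by rewrite Ew set11.
  have [wX [wY wB]] : w \notin X /\ w \notin Y /\ w \in B.
    by move: wQ; rewrite in_setD in_setU negb_or => /andP[/andP[]].
  have wK x : x \in [set a; b; p; q; s] -> w != x.
    by move=> xK; apply: contraTneq wB => ->; rewrite inE xK.
  have cX : #|opp a X| = 4.
    apply/eqP; rewrite eqn_leq (m _ _ (sep_opp hX)) andbT oXE.
    by apply: leq_trans (cards_le _ _ _ _) _; rewrite c1 c4.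
  have cY : #|opp b Y| = 4.
    apply/eqP; rewrite eqn_leq (m _ _ (sep_opp hY)) andbT oYE.
    by apply: leq_trans (cards_le _ _ _ _) _; rewrite c1 c3.
  have mX := minsep_card4 (sep_opp hX) cX; have mY := minsep_card4 (sep_opp hY) cY.
  have rX := minsep4_rk mX cX; have rY := minsep4_rk mY cY.
  have wa := wK a; have wb := wK b; have wp := wK p; have wq := wK q; have ws := wK s.
  rewrite !inE !eqxx ?orbT in wa wb wp wq ws.
  have {}wa := wa isT; have {}wb := wb isT; have {}wp := wp isT.
  have {}wq := wq isT; have {}ws := ws isT.
  have p1 : 2 < r [set p; s; w].
    apply: (rk_three mX cX); rewrite // ?[_ == w]eq_sym // !inE negb_or.
    - by rewrite [p == a]eq_sym ap.
    - by rewrite [s == a]eq_sym as_.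
    - by rewrite wa.
  have p2 : 2 < r [set p; q; w].
    apply: (rk_three mY cY); rewrite // ?[_ == w]eq_sym // !inE negb_or.
    - by rewrite [p == b]eq_sym bp.
    - by rewrite [q == b]eq_sym bq.
    - by rewrite wb.
  (* [W] is the union of two planes through [p] and [w], so its rank is at most 4; besides [Q2] it
     misses only [a] and [b]. *)
  apply: (nine_points (S := Q2) (z := z) (W := opp a X :|: opp b Y)) => //.
  + by have := cardsC Q2; rewrite cardT; nat_lia.
  + apply: (span (w := w) rX rY).
    * exists [set p; s; w]; split=> //.
      by rewrite K5 /opp; set_auto.
    * exists [set p; q; w]; split=> //.
      by rewrite K5 /opp; set_auto.
    * by rewrite K5 /Q2 /B /opp; set_auto.
  + have zo : z \in opp b Y by rewrite !inE negb_or zY zK // !inE eqxx orbT.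
    by rewrite (minsep_rkU1 mY zo) // oppK // /Q2; set_auto.
  + have : b |: (z |: Q2) \subset X by rewrite /Q2; set_auto.
    move/rkS; rewrite rkK; first by case/sepP: hX => _ _ _; nat_lia.
      by rewrite !inE eqxx orbT.
    by rewrite subUset sub1set zB.
  + by rewrite /Q2 /opp; set_auto.
  + apply: leq_trans (subset_leq_card (_ : _ \subset [set a; b])) _.
      by rewrite /Q2 /B /opp; set_auto.
    by rewrite cards2 ab.
  + have := @rkUI_sub (opp a X) (opp b Y) _ [set p; w] (subxx _).
    have -> : [set p; w] \subset opp a X :&: opp b Y by rewrite /opp; set_auto.
    by rewrite rk2 1?eq_sym // => /(_ isT); nat_lia.
- have /cards1P[w Ew] : #|Q2| == 1 by rewrite c2.
  have wQ : w \in Q2 by rewrite Ew set11.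
  have [wB [wX wY]] : w \in B /\ w \in X /\ w \in Y.
    by move: wQ; rewrite !in_setI => /and3P[].
  have wK x : x \in [set a; b; p; q; s] -> w != x.
    by move=> xK; apply: contraTneq wB => ->; rewrite inE xK.
  have cX : #|X| = 4.
    apply/eqP; rewrite eqn_leq (m _ _ hX) andbT XE.
    by apply: leq_trans (cards_le _ _ _ _) _; rewrite c2 c3.
  have cY : #|Y| = 4.
    apply/eqP; rewrite eqn_leq (m _ _ hY) andbT YE.
    by apply: leq_trans (cards_le _ _ _ _) _; rewrite c2 c4.
  have mX := minsep_card4 hX cX; have mY := minsep_card4 hY cY.
  have rX := minsep4_rk mX cX; have rY := minsep4_rk mY cY.
  have wa := wK a; have wb := wK b; have wp := wK p; have wq := wK q; have ws := wK s.
  rewrite !inE !eqxx ?orbT in wa wb wp wq ws.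
  have {}wa := wa isT; have {}wb := wb isT; have {}wp := wp isT.
  have {}wq := wq isT; have {}ws := ws isT.
  have p1 : 2 < r [set q; b; w].
    by apply: (rk_three mX cX); rewrite // eq_sym.
  have p2 : 2 < r [set s; a; w].
    by apply: (rk_three mY cY); rewrite // eq_sym.
  have se : s != e by case: es => ->; rewrite eq_sym.
  have sA : s \in A.
    have : s \in e |: A by rewrite K5 !inE eqxx orbT.
    by rewrite !inE (negbTE se).
  (* The planes are now [Y] and [A], which share [s] and [a]; besides [Q1] their union misses only
     [e] and [z]. *)
  apply: (nine_points (S := Q1) (z := z) (W := Y :|: A)) => //.
  + by have := cardsC Q1; rewrite cardT; nat_lia.
  + apply: (span (w := w) rX rY).
    * exists [set q; b; w]; split=> //.
      by rewrite K5; set_auto.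
    * exists [set s; a; w]; split=> //.
      by rewrite K5; set_auto.
    * by rewrite K5 /Q1 /B; set_auto.
  + by rewrite (minsep_rkU1 mX zX) // oXE; set_auto.
  + have : p |: (z |: Q1) \subset opp b Y.
      by rewrite oYE Ez; apply/subsetP => y; rewrite !inE; do 2 case: (y == _); rewrite ?orbT //= => ->; rewrite orbT.
    move/rkS; rewrite rkK; first by case/sepP: hY => _ _ _; nat_lia.
      by rewrite !inE eqxx !orbT.
    by rewrite subUset sub1set zB.
  + rewrite /Q1 -oppA /opp; set_auto.
  + apply: leq_trans (subset_leq_card (_ : _ \subset e |: Q3)) _.
      by rewrite /Q1 /Q3 -oppA /opp; set_auto.
    by rewrite cardsU1 c3; case: (_ \notin _).
  + have := @rkUI_sub Y A _ [set s; a] (subxx _).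
    have -> : [set s; a] \subset Y :&: A by rewrite subUset !sub1set !inE sY sA aY aA.
    by rewrite rk2 1?eq_sym // (minsep4_rk hA cA) => /(_ isT); nat_lia.
Qed.

End FourPointSide.

Definition cut4 e A f C x :=
  [/\ cut e A f C, x \in A, x != f & forall y, y \in A -> (y \in C) = (y == x)].

Lemma minsep4_cut4 e A f : minsep e A -> #|A| = 4 -> f \in A ->
  exists C x, cut4 e A f C x.
Proof.
move=> hA cA fA; have [C cC] := minsep_cut hA fA.
have [/eqP/cards1P[x Ex] _] := minsep4_cross hA cA cC.
have inC y : y \in A -> (y \in C) = (y == x).
  by move=> yA; rewrite -[y == x]in_set1 -Ex inE yA.
have [xA xC] : x \in A /\ x \in C by apply/setIP; rewrite Ex set11.
exists C, x; split=> //; case: cC => _ /sep_notin fC _.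
by apply: contraNneq fC => <-.
Qed.

Lemma card4_set A a b c : #|A| = 4 -> a \in A -> b \in A -> c \in A ->
  a != b -> a != c -> b != c ->
  exists d, [/\ d \in A, d != a, d != b, d != c & A = [set a; b; c; d]].
Proof.
move=> cA aA bA cinA ab ac bc.
have c3 : #|[set a; b; c]| = 3 by rewrite -setUA cardsU1 cards2 bc !inE negb_or ab ac.
have s3 : [set a; b; c] \subset A by rewrite !subUset !sub1set aA bA.
have := cardsID [set a; b; c] A; rewrite (setIidPr s3) c3 cA => c1.
have /eqP/cards1P[d Ed] : #|A :\: [set a; b; c]| = 1 by nat_lia.
have : d \in A :\: [set a; b; c] by rewrite Ed set11.
rewrite !inE !negb_or => /andP[/andP[/andP[da db] dc] dA]; exists d; split=> //.
by rewrite -Ed setDE setUIr setUCr setIT; apply/esym/setUidPr.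
Qed.

Lemma cut4_chain e A a b c Ca Cb : minsep e A -> #|A| = 4 -> a \in A ->
  cut4 e A a Ca b -> cut4 e A b Cb c -> c != a -> R = 4 /\ #|T| = 9.
Proof.
move=> hA cA aA [[_ hCa eCa] bA ba inCa] [[_ hCb eCb] cinA cb inCb] ca.
have [ab ac bc] : [/\ a != b, a != c & b != c] by rewrite ![_ == a]eq_sym in ba ca *; rewrite [b == c]eq_sym.
have [d [dA da db dc AE]] := card4_set cA aA bA cinA ab ac bc.
have eA := sep_notin (proj1 hA).
have eb : e != b by apply: contraNneq eA => ->.
apply: (@four_point_side_nine e a b c e d A Ca (opp b Cb)) => //.
- by rewrite AE; apply/setP => y; rewrite !inE; do 5 case: (y == _).
- by right.
- exact: sep_opp.
- by rewrite inCa.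
- by rewrite inCa // (negbTE cb).
- by rewrite inCa // (negbTE db).
- by rewrite !inE inCb // (negbTE db) (negbTE dc).
- by rewrite !inE inCb // (negbTE ab) (negbTE ac).
- by rewrite !inE inCb // eqxx orbT.
- by rewrite !inE eCb orbT.
Qed.

Lemma cut4_pairs e A a b c d Ca Cc : minsep e A -> #|A| = 4 -> a \in A -> c \in A ->
  cut4 e A a Ca b -> cut4 e A c Cc d -> uniq [:: a; b; c; d] -> R = 4 /\ #|T| = 9.
Proof.
move=> hA cA aA cinA [[_ hCa eCa] bA _ inCa] [[_ hCc eCc] dA _ inCc].
rewrite /= !inE !negb_or => /and4P[/and3P[ab ac ad] /andP[bc bd] cd _].
have [z [_ _ _ _ AE]] := card4_set cA aA bA cinA ab ac bc.
have {z AE} AE : A = [set a; b; c; d].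
  have : d \in A by [].
  rewrite AE !inE ![d == _]eq_sym (negbTE ad) (negbTE bd) (negbTE cd) /= => /eqP zd.
  by rewrite zd.
have eA := sep_notin (proj1 hA).
have ea : e != a by apply: contraNneq eA => ->.
have ec : e != c by apply: contraNneq eA => ->.
apply: (@four_point_side_nine e a c e d b A (opp a Ca) (opp c Cc)) => //.
- by rewrite AE; apply/setP => y; rewrite !inE; do 5 case: (y == _).
- by left.
- exact: sep_opp.
- exact: sep_opp.
- by rewrite !inE inCa // ![d == _]eq_sym (negbTE ad) (negbTE bd).
- by rewrite !inE inCa // ![c == _]eq_sym (negbTE ac) (negbTE bc).
- by rewrite !inE eCa orbT.
- by rewrite !inE inCa // eqxx orbT.
- by rewrite !inE inCc // (negbTE bc) (negbTE bd).
- by rewrite !inE inCc // (negbTE ac) (negbTE ad).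
- by rewrite !inE eCc orbT.
- by rewrite !inE inCc // eqxx orbT.
Qed.

(** Each point of [A] is sent to the one other point of [A] that its cut keeps. On four points this
    gives either a chain of three distinct points or two disjoint pairs. *)
Lemma minsep4_nine e A : minsep e A -> #|A| = 4 -> R = 4 /\ #|T| = 9.
Proof.
move=> hA cA; have /card_gt0P[a aA] : 0 < #|A| by rewrite cA.
have [Ca [b cCa]] := minsep4_cut4 hA cA aA; have [_ bA ba _] := cCa.
have [Cb [c cCb]] := minsep4_cut4 hA cA bA.
have [Eca|ca] := eqVneq c a; last exact: cut4_chain hA cA aA cCa cCb ca.
rewrite {c}Eca in cCb.
have /card_gt0P[c] : 0 < #|A :\ a :\ b|.
  have := cardsD1 a A; have := cardsD1 b (A :\ a).
  by rewrite aA !inE ba bA cA /=; nat_lia.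
rewrite !inE => /and3P[cb ca cinA].
have [Cc [d cCc]] := minsep4_cut4 hA cA cinA; have [_ dA dc _] := cCc.
have [Eda|da] := eqVneq d a.
  by rewrite Eda in cCc; apply: cut4_chain hA cA cinA cCc cCa _; rewrite eq_sym.
have [Edb|db] := eqVneq d b.
  by rewrite Edb in cCc; apply: cut4_chain hA cA cinA cCc cCb _; rewrite eq_sym.
apply: cut4_pairs hA cA aA cinA cCa cCc _.
by rewrite /= !inE !negb_or [a == b]eq_sym [a == c]eq_sym [a == d]eq_sym [b == c]eq_sym [b == d]eq_sym [c == d]eq_sym ba ca da cb db dc.
Qed.

Lemma minsep_ex : exists e A, minsep e A.
Proof.
have /card_gt0P[e0 _] : 0 < #|[set: T]| by have := rk_card [set: T]; nat_lia.
have [X0 hX0] := sep_ex e0.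
pose P n := [exists e, [exists X, sep e X && (#|X| == n)]].
have exP : exists n, P n.
  by exists #|X0|; apply/existsP; exists e0; apply/existsP; exists X0; rewrite hX0 eqxx.
case: (ex_minnP exP) => n /existsP[e /existsP[A /andP[hA /eqP cA]]] minn.
exists e, A; split=> // f X hX; rewrite cA; apply: minn.
by apply/existsP; exists f; apply/existsP; exists X; rewrite hX eqxx.
Qed.

Lemma high_rank_nine : R = 4 /\ #|T| = 9.
Proof.
have [e [A hA]] := minsep_ex; have c4 := minsep_card_ge4 hA; have c6 := minsep_card_le6 hA.
have [|n4] := eqVneq #|A| 4; first exact: minsep4_nine hA.
have [|n5] := eqVneq #|A| 5; first by move/(minsep_card_neq5 hA).
have [|n6] := eqVneq #|A| 6; first by move/(minsep_card_neq6 hA).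
by move: c4 c6 n4 n5 n6; clear; lia.
Qed.

(** * Nine points in rank four *)

(** Five points would leave at most four outside, so [small4] would give them full rank. *)
Lemma nine_plane_card S : R = 4 -> r S <= 3 -> #|T| = 9 -> #|S| <= 4.
Proof.
move=> R4 rS T9; rewrite leqNgt; apply/negP => cS.
have := small4 (S := ~: S); rewrite setCK; have := cardsC S => c1.
suff h : #|~: S| <= 4 by move/(_ h); nat_lia.
by nat_lia.
Qed.

Section NinePoints.

Hypotheses (R4 : R = 4) (T9 : #|T| = 9).

Let plane_card S : r S <= 3 -> #|S| <= 4.
Proof. by move=> rS; apply: nine_plane_card. Qed.

Let split9 g : exists X, [/\ g \notin X, #|X| = 4, r X = 3,
  #|opp g X| = 4 & r (opp g X) = 3].
Proof.
have [X /sepP[gX r1 r2 r12]] := sep_ex g; exists X.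
have c := card_opp gX.
have e1 : r X = 3 by nat_lia.
have e2 : r (opp g X) = 3 by nat_lia.
have := @plane_card X; have := @plane_card (opp g X); rewrite e1 e2.
by move=> /(_ isT) ? /(_ isT) ?; split=> //; nat_lia.
Qed.

(** For [g] off a three-point line, two of its points lie on one side [Z], and then all three do,
    since planes have at most four points. So [g |: Z] is the line with two more elements, and
    [small] contradicts [r (opp g Z) = 3]. *)
Let rk_three9 L : 2 < #|L| -> 2 < r L.
Proof.
move=> cL; rewrite ltnNge; apply/negP => rL.
have c3 := line_card rL.
have /card_gt0P[g gL] : 0 < #|~: L| by have := cardsC L; nat_lia.
rewrite inE in gL; have [X [gX cX rX cY rY]] := split9 g.
have key (Z : {set T}) : g \notin Z -> #|Z| = 4 -> r Z = 3 -> r (opp g Z) = 3 -> 1 < #|L :&: Z| -> False.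
  move=> gZ cZ rZ roZ m; have c1 := cardsUI L Z; have := rkUI L Z.
  have rm := rk_gt1 m => h.
  have := @plane_card (L :|: Z); have hr : r (L :|: Z) <= 3 by nat_lia.
  move/(_ hr) => c4; have cI : #|L :&: Z| = 3.
    by have := subset_leq_card (subsetIl L Z); nat_lia.
  have sLZ : L \subset Z.
    by apply/setIidPl/eqP; rewrite eqEcard subsetIl cI; nat_lia.
  have sLgZ : L \subset g |: Z by apply: subset_trans sLZ (subsetUr _ _).
  have := small sLgZ rL; rewrite -/(opp g Z) roZ R4 => k.
  suff h4 : #|(g |: Z) :\: L| <= 2 by have := k h4.
  have := cardsID L (g |: Z); rewrite (setIidPr sLgZ) cardsU1 gZ cZ.
  by nat_lia.
have [m|m] := ltnP 1 #|L :&: X|; first exact: (key X).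
apply: (key (opp g X)); rewrite ?oppK //; first exact: opp_notin.
have := cardsID X L; have -> : L :\: X = L :&: opp g X by rewrite /opp; set_auto.
by nat_lia.
Qed.

Let plane_meet X Y : #|X| = 4 -> #|Y| = 4 -> r X <= 3 -> r Y <= 3 ->
  2 < #|X :&: Y| -> X = Y.
Proof.
move=> cX cY rX rY m; have := rkUI X Y; have := rk_three9 m => h1 h2.
have h3 : #|X :|: Y| <= 4 by apply: plane_card; nat_lia.
have h4 := subset_leq_card (subsetUl X Y).
have e1 : X = X :|: Y by apply/eqP; rewrite eqEcard subsetUl; nat_lia.
have e2 : Y = X :|: Y by apply/eqP; rewrite eqEcard subsetUr; nat_lia.
by rewrite e1 -e2.
Qed.

Section Labelling.

Variables (x0 : T) (q : seq T).
Hypotheses (uq : uniq q) (sq : size q = 9).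

(* Points are labelled by their positions in q; the planes to be searched for are
   the increasing lists D of labels. *)
Let m (c : seq nat) : {set T} := [set x in [seq nth x0 q i | i <- c]].

Let D (c : seq nat) :=
  [&& sorted ltn c, all (gtn 9) c, size c == 4 & r (m c) <= 3].

Let nth_inj i j : i < 9 -> j < 9 -> nth x0 q i = nth x0 q j -> i = j.
Proof. by move=> i9 j9 /eqP; rewrite nth_uniq ?sq // => /eqP. Qed.

Let card_m c : uniq c -> all (gtn 9) c -> #|m c| = size c.
Proof.
move=> uc /allP c9; rewrite cardsE -(size_map (nth x0 q)); apply/card_uniqP.
by rewrite map_inj_in_uniq // => i j /c9 i9 /c9 j9; apply: nth_inj.
Qed.

Let mem_m c i : all (gtn 9) c -> i < 9 -> (nth x0 q i \in m c) = (i \in c).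
Proof.
move=> /allP c9 i9; rewrite inE; apply/mapP/idP => [[j jc]|ic]; last by exists i.
by move/(nth_inj i9 (c9 j jc)) ->.
Qed.

Let D_compat b c : D b -> D c -> compat b c.
Proof.
move=> /and4P[sb b9 /eqP zb rb] /and4P[sc c9 /eqP zc rc].
rewrite /compat meet_sizeE; case: leqP => // cnt.
have ub := sorted_uniq ltn_trans ltnn sb; have uc := sorted_uniq ltn_trans ltnn sc.
have E : m b = m c.
  apply: plane_meet; rewrite ?card_m //.
  have f9 : all (gtn 9) (filter (mem c) b).
    by apply/allP => i; rewrite mem_filter => /andP[_ /(allP b9)].
  have <- : m (filter (mem c) b) = m b :&: m c.
    apply/setP => x; rewrite in_setI; apply/idP/andP.
      rewrite !inE => /mapP[i]; rewrite mem_filter => /andP[ic ib] ->.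
      by split; apply: map_f.
    rewrite !inE => -[/mapP[i ib ->] /mapP[j jc]].
    move=> /(nth_inj (allP b9 i ib) (allP c9 j jc)) ij.
    by apply: map_f; rewrite mem_filter ib /= ij jc.
  by rewrite card_m ?filter_uniq // size_filter.
apply/eqP/(irr_sorted_eq ltn_trans ltnn sb sc) => i.
have [i9|i9] := ltnP i 9; first by rewrite -!mem_m // E.
by apply/idP/idP => [/(allP b9)|/(allP c9)]; rewrite /= ltnNge i9.
Qed.

Let D_splits (g : nat) : g < 9 -> exists2 xy, xy \in splits g & D xy.1 && D xy.2.
Proof.
move=> g9; set o := rem g (iota 0 9).
have uo : uniq o by apply: rem_uniq; apply: iota_uniq.
have mo i : (i \in o) = (i != g) && (i < 9).
  by rewrite mem_rem_uniq ?iota_uniq // inE mem_iota.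
have so : size o = 8 by rewrite size_rem // mem_iota.
have sto : sorted ltn o.
  by apply: (subseq_sorted ltn_trans (rem_subseq _ _)); apply: iota_ltn_sorted.
case Eo : o so => [|o0 o'] //= [so'].
(* [splits] puts the half with the least label first, so the side through that label is taken as
   [X]. *)
have [X [gX [cX rX] [cY rY] oX]] : exists X, [/\ nth x0 q g \notin X, #|X| = 4 /\ r X = 3,
    #|opp (nth x0 q g) X| = 4 /\ r (opp (nth x0 q g) X) = 3 & nth x0 q o0 \in X].
  have [X [gX cX rX cY rY]] := split9 (nth x0 q g).
  have [oX|oX] := boolP (nth x0 q o0 \in X); first by exists X.
  exists (opp (nth x0 q g) X); rewrite oppK // opp_notin; split=> //.
  have : o0 \in o by rewrite Eo mem_head.
  rewrite mo => /andP[og o9]; rewrite !inE negb_or oX andbT.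
  by apply: contraNneq og => /(nth_inj o9 g9) ->.
set s := [seq i <- o' | nth x0 q i \in X].
have surj x : exists2 i, i < 9 & x = nth x0 q i.
  have xq : x \in q.
    have : #|q| = #|T| by rewrite T9 -sq; apply/card_uniqP.
    by move/subset_cardP => /(_ (subset_predT _)) ->.
  by exists (index x q); rewrite ?nth_index // -sq index_mem.
have o9 : all (gtn 9) o by apply/allP => i; rewrite mo => /andP[].
have EX : m (o0 :: s) = X.
  have -> : o0 :: s = [seq i <- o | nth x0 q i \in X] by rewrite Eo /= oX.
  apply/setP => x; have [i i9 ->] := surj x.
  rewrite mem_m //; last by apply/allP => j; rewrite mem_filter => /andP[_ /(allP o9)].
  rewrite mem_filter mo i9 andbT; case: eqP => [->|_]; rewrite ?andbT // andbF.
  by rewrite (negbTE gX).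
have EY : m [seq i <- o' | i \notin s] = opp (nth x0 q g) X.
  have -> : [seq i <- o' | i \notin s] = [seq i <- o | nth x0 q i \notin X].
    rewrite Eo /= oX /=; apply: eq_in_filter => i io'.
    by rewrite mem_filter io' andbT.
  apply/setP => x; have [i i9 ->] := surj x.
  rewrite mem_m //; last by apply/allP => j; rewrite mem_filter => /andP[_ /(allP o9)].
  rewrite mem_filter mo i9 andbT !inE negb_or andbC; congr (_ && _); congr negb.
  by apply/eqP/eqP => [->//|/(nth_inj i9 g9)].
have so1 : subseq (o0 :: s) o by rewrite Eo /= eqxx filter_subseq.
have so2 : subseq [seq i <- o' | i \notin s] o.
  by rewrite Eo; apply: subseq_trans (subseq_cons _ _); apply: filter_subseq.
have sub9 c : subseq c o -> all (gtn 9) c.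
  by move=> /mem_subseq sub; apply/allP => i /sub /(allP o9).
have Dsub c : subseq c o -> #|m c| = 4 -> r (m c) = 3 -> D c.
  move=> sub c4 c3; apply/and4P; split; rewrite ?c3 //.
  - exact: (subseq_sorted ltn_trans sub).
  - exact: sub9.
  - by rewrite -card_m ?c4 ?(subseq_uniq sub) ?sub9.
exists (o0 :: s, [seq i <- o' | i \notin s]).
  rewrite /splits -/o Eo; apply/mapP; exists s => //.
  suff <- : size s = 3 by apply: mem_ksubseqs; apply: filter_subseq.
  have := card_m (subseq_uniq so1 uo) (sub9 _ so1).
  by rewrite EX cX => -[].
by rewrite /= !Dsub ?EX ?EY.
Qed.

Lemma nine_labelling_iso : D [:: 0; 1; 2; 3] -> D [:: 4; 5; 6; 7] ->
  exists h : 'I_9 -> T, injective h /\ forall U : {set 'I_9}, r (h @: U) = N9_rank U.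
Proof.
move=> d1 d2.
have hs (g : nat) : g < 8 -> exists2 xy, xy \in splits g & D xy.1 && D xy.2.
  by move=> g8; apply: D_splits; apply: leq_trans g8 _.
have d12 : all D [:: [:: 0; 1; 2; 3]; [:: 4; 5; 6; 7]] by rewrite /= d1 d2.
have [P PP [cs acs pl]] := all_packings_placedP hs D_compat d12 packings_of_8.
have P9 : perm_eq P (iota 0 9) := allP placements_perm P PP.
have memP i : (i \in P) = (i < 9) by rewrite (perm_mem P9) mem_iota.
have idx i : i < 9 -> index i P < 9.
  by move=> i9; rewrite -(size_iota 0 9) -(perm_size P9) index_mem memP.
pose h (i : 'I_9) := nth x0 q (index (val i) P).
have h_inj : injective h.
  move=> i j /(nth_inj (idx _ (ltn_ord i)) (idx _ (ltn_ord j))) E.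
  have [iP jP] : val i \in P /\ val j \in P by split; rewrite memP; apply: ltn_ord.
  by apply: val_inj; rewrite -[LHS](nth_index 0 iP) -[RHS](nth_index 0 jP); congr nth.
have all9 c : c \in ksubseqs 4 (iota 0 9) -> #|h @: ords c| = 4.
  move=> cS; have sub := ksubseqs_subseq cS.
  rewrite card_imset // card_ords_uniq ?(size_ksubseqs cS) //.
    exact: subseq_uniq sub (iota_uniq _ _).
  exact: mem_subseq.
have planeS c : c \in N9_planes -> c \in ksubseqs 4 (iota 0 9).
  exact: (allP (_ : all (mem (ksubseqs 4 (iota 0 9))) N9_planes)).
have planes c : c \in N9_planes -> r (h @: ords c) <= 3.
  move=> cP; move: pl; rewrite /placed lazy_allE => /allP/(_ c cP).
  rewrite lazy_hasE => /hasP[b bcs]; rewrite lazy_allE => /allP sub.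
  have /and4P[_ _ _ rb] := allP acs b bcs; apply: leq_trans rb; apply: rkS.
  apply/subsetP => x /imsetP[i]; rewrite inE => ic ->; rewrite inE; apply: map_f.
  by rewrite -lazy_memE; apply: sub; apply: (map_f (index^~ P)).
exists h; split=> //; apply: N9_rank_unique.
- by move=> U; rewrite -(card_imset (mem U) h_inj).
- by move=> U V UV; apply/rkS/imsetS.
- by move=> U V; rewrite imsetU; apply: leq_trans (rkUI _ _); apply: leq_addr.
- by move=> U; have := rkT (h @: U); rewrite R4.
- exact: planes.
move=> c; rewrite mem_filter => /andP[cP cS].
case/orP: (allP N9_nonplane_meet c cS) => [|/hasP[b bP /eqP cnt]].
  by rewrite (negbTE cP).
rewrite leqNgt; apply/negP => rc.
have uc := subseq_uniq (ksubseqs_subseq cS) (iota_uniq 0 9).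
have := cnt; have := plane_meet (all9 c cS) (all9 b (planeS b bP)) rc (planes b bP).
have E : ords (filter (mem b) c) = ords c :&: ords b.
  by apply/setP => i; rewrite !inE mem_filter andbC.
have c3 : #|h @: (ords c :&: ords b)| = 3.
  rewrite -E card_imset // card_ords_uniq ?filter_uniq ?size_filter //.
  by move=> i; rewrite mem_filter => /andP[_ /(mem_subseq (ksubseqs_subseq cS))].
rewrite imsetI in c3; last by move=> i j _ _; apply: h_inj.
rewrite c3 => /(_ isT) Ebc _; move: c3; rewrite Ebc setIid all9 //.
exact: planeS.
Qed.

End Labelling.

Lemma nine_points_iso :
  exists h : 'I_9 -> T, injective h /\ forall U : {set 'I_9}, r (h @: U) = N9_rank U.
Proof.
have /card_gt0P[x0 _] : 0 < #|T| by rewrite T9.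
have [X [gX cX rX cY rY]] := split9 x0.
have s1 : size (enum X) = 4 by rewrite -cardE.
have s2 : size (enum (opp x0 X)) = 4 by rewrite -cardE.
(* This order gives the two planes of the split at [x0] the labels 0123 and 4567, and [x0] the label
   8, where the search starts. *)
pose q := enum X ++ enum (opp x0 X) ++ [:: x0].
have sq : size q = 9 by rewrite !size_cat s1 s2.
have uq : uniq q.
  rewrite cat_uniq cat_uniq !enum_uniq /= !orbF !andbT; apply/andP; split; last first.
    by rewrite mem_enum opp_notin.
  apply/hasPn => y; rewrite mem_cat mem_enum mem_seq1 mem_enum.
  by case/orP => [|/eqP->//]; rewrite !inE negb_or => /andP[].
have e1 : [set x in [seq nth x0 q i | i <- [:: 0; 1; 2; 3]]] = X.
  apply/setP => y; rewrite inE -(mem_enum X).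
  have -> // : [seq nth x0 q i | i <- [:: 0; 1; 2; 3]] = enum X.
  have -> : [:: 0; 1; 2; 3] = iota 0 (size (enum X)) by rewrite s1.
  rewrite -[RHS](mkseq_nth x0); apply/eq_in_map => i; rewrite mem_iota => /andP[_ i4].
  by rewrite nth_cat i4.
have e2 : [set x in [seq nth x0 q i | i <- [:: 4; 5; 6; 7]]] = opp x0 X.
  apply/setP => y; rewrite inE -(mem_enum (opp x0 X)).
  have -> // : [seq nth x0 q i | i <- [:: 4; 5; 6; 7]] = enum (opp x0 X).
  have -> : [:: 4; 5; 6; 7] = map (addn 4) (iota 0 (size (enum (opp x0 X)))) by rewrite s2.
  rewrite -map_comp -[RHS](mkseq_nth x0); apply/eq_in_map => i; rewrite mem_iota => /andP[_ i4].
  by rewrite /= nth_cat s1 ltnNge leq_addr /= addKn nth_cat i4.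
by apply: (nine_labelling_iso (x0 := x0) uq sq); rewrite /= ?e1 ?e2 ?rX ?rY.
Qed.

End NinePoints.

End HighRank.

(** * Minimally vertically 4-connected matroids *)

Section Minimal.

Hypothesis vconn : forall j X, 0 < j -> j < 4 -> j <= r X -> j <= r (~: X) ->
  R + j <= r X + r (~: X).
Hypothesis minimal : forall e, exists j X, [/\ e \notin X, 0 < j, j < 4 &
  [/\ j <= r X, j <= r (opp e X) & r X + r (opp e X) < r (~: [set e]) + j]].
Hypothesis card_ge6 : 6 <= #|T|.

Definition cocirc C := minset (fun S => r (~: S) < R) C.

Hypothesis no_cocirc4 : forall C, cocirc C -> #|C| != 4.
(** Independence of pairs, needed to make [L] a circuit, is proved only later in this section; it is
    therefore handed over when the hypothesis is applied. *)
Hypothesis no_cocirc5 : forall C L, cocirc C -> #|C| = 5 -> L \subset C ->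
  #|L| = 3 -> r L <= 2 -> (forall x y, x != y -> r [set x; y] = 2) -> False.

Lemma cocirc_sub S : r (~: S) < R -> exists2 C, cocirc C & C \subset S.
Proof.
by move=> h; have [C hC sCS] := minset_exists (P := fun S => r (~: S) < R) h; exists C.
Qed.

(** By [vconn], adding [e] raises the rank of either side. If [j < 3] and one side had rank above
    [j], adding [e] to the other would violate [vconn] for [j.+1]. *)
Lemma minimal_cases e : exists j X, [/\ e \notin X,
  r (e |: X) = (r X).+1, r (e |: opp e X) = (r (opp e X)).+1 &
  sep e X \/ [/\ 0 < j < 3, r X = j, r (opp e X) = j & R = j.+1]].
Proof.
have [j [X [eX j0 j4 [h1 h2 h3]]]] := minimal e; exists j, X.
have rT := rkT (~: [set e]).
have E2 : ~: (e |: opp e X) = X by rewrite -[RHS](oppK eX).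
have m1 := rkS (subsetUr [set e] X); have m2 := rkS (subsetUr [set e] (opp e X)).
have u1 := rkU1 e X; have u2 := rkU1 e (opp e X).
have a1 := vconn (X := e |: X) j0 j4; have a2 := vconn (X := e |: opp e X) j0 j4.
rewrite -/(opp e X) E2 in a1 a2.
have {}a1 := a1 (leq_trans h1 m1) h2; have {}a2 := a2 (leq_trans h2 m2) h1.
have [b1 b2] : r (e |: X) = (r X).+1 /\ r (e |: opp e X) = (r (opp e X)).+1.
  by split; nat_lia.
split=> //; have [j3|j3] := leqP 3 j.
  have {}j3 : j = 3 by nat_lia.
  by left; apply/sepP; split=> //; nat_lia.
right; have c1 := vconn (j := j.+1) (X := e |: X) isT.
have c2 := vconn (j := j.+1) (X := e |: opp e X) isT.
rewrite -/(opp e X) E2 in c1 c2.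
have [d1|d1] := ltnP j (r (opp e X)).
  have : R + j.+1 <= r (e |: X) + r (opp e X) by apply: c1 => //; nat_lia.
  by nat_lia.
have [d2|d2] := ltnP j (r X).
  have : R + j.+1 <= r (e |: opp e X) + r X by apply: c2 => //; nat_lia.
  by nat_lia.
by split; rewrite ?j0 //; nat_lia.
Qed.

Let unspanned_elt e : exists X,
  [/\ r (e |: X) = (r X).+1 & r (e |: opp e X) = (r (opp e X)).+1].
Proof. by have [j [X [_ h1 h2 _]]] := minimal_cases e; exists X. Qed.

Let rk2 := unspanned_rk2 unspanned_elt.
Let rk_gt1 := unspanned_rk_gt1 unspanned_elt.
Let line_card := unspanned_line_card unspanned_elt.

(** Rank 2 leaves at most three points. In rank 3, the absence of four-element cocircuits forces six
    points with every pair on a three-point line; but the three points off [L] cannot be paired up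
    by lines through a point [x] of [L]. *)
Lemma minimal_rank_ge4 : 3 < R.
Proof.
rewrite ltnNge; apply/negP => R3.
have /card_gt0P[e _] : 0 < #|T| by nat_lia.
have [j [X [eX _ _ [/sepP[_ h1 h2 h3]|[j12 r1 r2 Rj]]]]] := minimal_cases e.
  by nat_lia.
have cT := card_opp eX.
have {j12} [j1|j2] : j = 1 \/ j = 2 by case/andP: j12; clear; lia.
  have [c|c] := ltnP 1 #|X|; first by have := rk_gt1 c; nat_lia.
  have [c'|c'] := ltnP 1 #|opp e X|; first by have := rk_gt1 c'; nat_lia.
  by nat_lia.
have [l1 l2] : #|X| <= 3 /\ #|opp e X| <= 3 by split; apply: line_card; nat_lia.
have coline S : r S <= 2 -> exists2 C, cocirc C & C \subset ~: S.
  by move=> rS; apply: cocirc_sub; rewrite setCK; nat_lia.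
have line_compl C : cocirc C -> #|~: C| <= 3.
  by case/minsetP => rC _; apply: line_card; nat_lia.
have [L [cL rL]] : exists L : {set T}, #|L| = 3 /\ r L = 2.
  have [c3|c3] : #|X| = 3 \/ #|opp e X| = 3 by nat_lia.
    by exists X; rewrite c3 r1 j2.
  by exists (opp e X); rewrite c3 r2 j2.
have cLc := cardsC L.
have T6 : #|T| = 6.
  have [C cC sC] : exists2 C, cocirc C & C \subset ~: L by apply: coline; rewrite rL.
  have c1 := line_compl C cC; have c2 := cardsC C; have c3 := subset_leq_card sC.
  suff c4 : #|C| <> 4 by move: c1 c2 c3 c4 cLc cL l1 l2 cT card_ge6; clear; lia.
  by apply/eqP/no_cocirc4.
have third x y : x != y -> exists z, [/\ z != x, z != y & r [set x; y; z] <= 2].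
  move=> xy; have c2 : #|[set x; y]| = 2 by rewrite cards2 xy.
  have [C cC sC] : exists2 C, cocirc C & C \subset ~: [set x; y].
    by apply: coline; rewrite rk2.
  have sxy : [set x; y] \subset ~: C by rewrite -setCS setCK.
  have c3 := cardsC C; have c4 := line_compl C cC.
  have c5 : #|C| <> 4 by apply/eqP/no_cocirc4.
  have c6 := subset_leq_card sC; have c7 := cardsC [set x; y].
  have c8 := cardsID [set x; y] (~: C); rewrite (setIidPr sxy) c2 in c8.
  have /card_gt0P[z] : 0 < #|~: C :\: [set x; y]|.
    by move: c3 c4 c5 c6 c7 c8 c2 T6; clear; lia.
  rewrite !inE negb_or => /andP[/andP[zx zy] zC]; exists z; split=> //.
  case/minsetP: cC => rC _; suff : [set x; y; z] \subset ~: C by move/rkS; nat_lia.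
  by rewrite subUset sxy sub1set inE.
have join A B : r A <= 2 -> r B <= 2 -> 1 < #|A :&: B| -> #|A :|: B| <= 3.
  by move=> rA rB m; apply: line_card; have := rkUI A B; have := rk_gt1 m; nat_lia.
have c3 x y z : x != y -> z != x -> z != y -> #|[set x; y; z]| = 3.
  move=> xy zx zy; rewrite -setUA cardsU1 cards2 !inE negb_or xy eq_sym zx.
  by rewrite eq_sym zy.
have /card_gt0P[x xL] : 0 < #|L| by rewrite cL.
have off y z : y \notin L -> z != x -> r [set x; y; z] <= 2 -> z \notin L.
  move=> yL zx rA; apply/negP => zL.
  have : #|[set x; y; z] :|: L| <= 3.
    apply: join => //; first by rewrite rL.
    by apply/card_gt1P; exists x, z; split; rewrite 1?eq_sym // !inE eqxx ?xL ?zL ?orbT.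
  have : y |: L \subset [set x; y; z] :|: L.
    by apply/subsetP => t; rewrite !inE => /orP[->|->]; rewrite ?orbT.
  by move/subset_leq_card; rewrite cardsU1 yL cL; nat_lia.
have /card_gt0P[y1] : 0 < #|~: L| by nat_lia.
rewrite inE => y1L; have xy1 : x != y1 by apply: contraNneq y1L => <-.
have [z [zx zy1 rA]] := third x y1 xy1; have zL := off y1 z y1L zx rA.
have xz : x != z by rewrite eq_sym.
have cA := c3 x y1 z xy1 zx zy1.
have /card_gt0P[y3] : 0 < #|(~: L) :\ y1 :\ z|.
  have := cardsD1 y1 (~: L); have := cardsD1 z ((~: L) :\ y1).
  by rewrite !inE y1L zL zy1; nat_lia.
rewrite !inE => /and3P[y3z y3y1 y3L].
have xy3 : x != y3 by apply: contraNneq y3L => <-.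
have [w [wx wy3 rA']] := third x y3 xy3; have wL := off y3 w y3L wx rA'.
have Lc : ~: L = [set y1; z; y3].
  have y1z : y1 != z by rewrite eq_sym.
  apply/esym/eqP; rewrite eqEcard (c3 y1 z y3 y1z y3y1 y3z).
  apply/andP; split; last by nat_lia.
  by rewrite !subUset !sub1set !inE y1L zL.
have : w \in ~: L by rewrite inE.
rewrite Lc !inE (negbTE wy3) orbF => w1.
have : #|[set x; y1; z] :|: [set x; y3; w]| <= 3.
  apply: join => //; apply/card_gt1P; exists x, w; split; last by rewrite eq_sym.
    by rewrite !inE eqxx.
  by rewrite !inE eqxx orbT andbT -orbA w1 orbT.
have : y3 |: [set x; y1; z] \subset [set x; y1; z] :|: [set x; y3; w].
  by apply/subsetP => t; rewrite !inE => /orP[->|->]; rewrite ?orbT.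
move/subset_leq_card; rewrite cardsU1 cA !inE !negb_or [y3 == x]eq_sym xy3 y3y1 y3z /=.
by nat_lia.
Qed.

Let R_ge4 := minimal_rank_ge4.

Let conn2 X : 1 < r X -> 1 < r (~: X) -> R + 2 <= r X + r (~: X).
Proof. exact: vconn. Qed.

Let conn3 X : 2 < r X -> 2 < r (~: X) -> R + 3 <= r X + r (~: X).
Proof. exact: vconn. Qed.

Let all_sep e : exists X, sep e X.
Proof.
have [j [X [_ _ _ [hX|[j12 _ _ Rj]]]]] := minimal_cases e; first by exists X.
by have := R_ge4; case/andP: j12; nat_lia.
Qed.

(** The complement of a cocircuit has rank [R - 1], at least 3. If [#|C| <= 3], [vconn] with
    [j = r C] would make that rank [R]. *)
Lemma cocirc_gt4 C : cocirc C -> 4 < #|C|.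
Proof.
move=> cC; have /eqP c4 := no_cocirc4 cC; case/minsetP: (cC) => rC minC.
have C0 : 0 < #|C|.
  rewrite lt0n cards_eq0; apply/eqP => C0.
  by move: rC; rewrite C0 setC0 ltnn.
case/card_gt0P: (C0) => x xC.
have r1 : R <= (r (~: C)).+1.
  have : ~ r (~: (C :\ x)) < R.
    move=> h; have := minC _ h (subD1set _ _) => E.
    by move: xC; rewrite -E !inE eqxx.
  have -> : ~: (C :\ x) = x |: ~: C by set_auto.
  by have := rkU1 x (~: C) => h /negP; rewrite -leqNgt; nat_lia.
suff c3 : 3 < #|C| by move: c3 c4; clear; lia.
rewrite ltnNge; apply/negP => c3; have rC3 := rk_card C.
have R4 := R_ge4.
have rC0 : 0 < r C.
  have [X [h1 _]] := unspanned_elt x; have := rkU1_sub (sub0set X) h1.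
  rewrite setU0 => h; have : [set x] \subset C by rewrite sub1set.
  by move/rkS; nat_lia.
have rCle : r C <= 3 := leq_trans rC3 c3.
have := vconn rC0 (_ : r C < 4) (leqnn _); rewrite ltnS => /(_ rCle).
have h : r C <= r (~: C) by nat_lia.
by move/(_ h); nat_lia.
Qed.

Let small4 S : #|S| <= 4 -> r (~: S) = R.
Proof.
move=> cS; apply/eqP; rewrite eqn_leq rkT leqNgt; apply/negP => /cocirc_sub[C cC sC].
by have := cocirc_gt4 cC; have := subset_leq_card sC; nat_lia.
Qed.

Let small5 S L : #|S| <= 5 -> L \subset S -> #|L| = 3 -> r L <= 2 -> r (~: S) = R.
Proof.
move=> cS sL cL rL; apply/eqP; rewrite eqn_leq rkT leqNgt; apply/negP.
move=> /cocirc_sub[C cC sC]; have c5 := cocirc_gt4 cC; have c6 := subset_leq_card sC.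
have ECS : C = S by apply/eqP; rewrite eqEcard sC; nat_lia.
by apply: (no_cocirc5 (C := C) (L := L)) => //; rewrite ?ECS //; rewrite ECS in c5; nat_lia.
Qed.

Lemma minimal_iso : #|T| = 9 /\
  exists h : 'I_9 -> T, injective h /\ forall U : {set 'I_9}, r (h @: U) = N9_rank U.
Proof.
have [R4 T9] := high_rank_nine R_ge4 conn2 conn3 all_sep small4 small5.
split=> //.
exact: nine_points_iso R_ge4 conn3 all_sep small4 small5 R4 T9.
Qed.

End Minimal.
End RankFunction.

(** * Passing to the type of elements of the ground set *)

Section GroundType.

Variables (T : finType) (M : matroid T).

Local Notation E := (ground M).

Definition ground_type := {x : T | x \in E}.

Definition lift_set (X : {set ground_type}) : {set T} := [set val x | x in X].

Definition ground_rk (X : {set ground_type}) := rk M (lift_set X).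

Lemma mem_lift_set X (x : ground_type) : (val x \in lift_set X) = (x \in X).
Proof. by apply/imsetP/idP => [[y yX /val_inj ->]|xX] //; exists x. Qed.

Lemma lift_set_sub X : lift_set X \subset E.
Proof. by apply/subsetP => x /imsetP[y _ ->]; apply: valP. Qed.

Lemma card_lift_set X : #|lift_set X| = #|X|.
Proof. by rewrite card_imset //; apply: val_inj. Qed.

Lemma lift_setS X Y : (lift_set X \subset lift_set Y) = (X \subset Y).
Proof.
apply/idP/idP => sXY; last exact: imsetS.
by apply/subsetP => x xX; rewrite -mem_lift_set (subsetP sXY) // mem_lift_set.
Qed.

Lemma lift_setT : lift_set setT = E.
Proof.
apply/eqP; rewrite eqEsubset lift_set_sub; apply/subsetP => x xE.
by apply/imsetP; exists (Sub x xE).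
Qed.

Lemma lift_setC X : lift_set (~: X) = E :\: lift_set X.
Proof.
apply/setP => x; rewrite in_setD; apply/imsetP/andP => [[y yX ->]|[xX xE]].
  by rewrite mem_lift_set -in_setC yX; split=> //; apply: valP.
by exists (Sub x xE) => //; rewrite inE -mem_lift_set SubK.
Qed.

Lemma lift_setU1 x X : lift_set (x |: X) = val x |: lift_set X.
Proof. by rewrite /lift_set imsetU1. Qed.

Lemma lift_set_onto (S : {set T}) : S \subset E -> exists X, S = lift_set X.
Proof.
move=> sS; exists [set x : ground_type | val x \in S]; apply/setP => x.
apply/idP/imsetP => [xS|[y]]; last by rewrite inE => yS ->.
by exists (Sub x (subsetP sS x xS)); rewrite ?inE SubK.
Qed.

Lemma ground_rk_card X : ground_rk X <= #|X|.
Proof. by rewrite -card_lift_set; apply/rk_le_card/lift_set_sub. Qed.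

Lemma ground_rkS (X Y : {set ground_type}) : X \subset Y -> ground_rk X <= ground_rk Y.
Proof. by move=> sXY; apply: rk_mono; rewrite ?lift_setS ?lift_set_sub. Qed.

Lemma ground_rkUI X Y :
  ground_rk (X :|: Y) + ground_rk (X :&: Y) <= ground_rk X + ground_rk Y.
Proof.
rewrite /ground_rk /lift_set imsetU imsetI; last by move=> x y _ _; apply: val_inj.
by apply: rk_submod; apply: lift_set_sub.
Qed.

Lemma ground_rkT : ground_rk setT = rk M E.
Proof. by rewrite /ground_rk lift_setT. Qed.

Lemma ground_connected j (X : {set ground_type}) : vertically_connected 4 M ->
  0 < j -> j < 4 -> j <= ground_rk X -> j <= ground_rk (~: X) ->
  ground_rk setT + j <= ground_rk X + ground_rk (~: X).
Proof.
move=> hM j0 j4 h1 h2; rewrite leqNgt; apply/negP => h3.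
apply: (hM j (lift_set X) (lift_set (~: X)) j0 j4); split.
- by rewrite lift_setC -{1}(setIidPr (lift_set_sub X)) setID.
- by rewrite lift_setC -setI_eq0 setIDA setD_eq0 subsetIl.
- by rewrite /connectivity -lift_setC -/(ground_rk X) -/(ground_rk _) -ground_rkT; lia.
- by rewrite leq_min h1 h2.
Qed.

Lemma ground_minimal (e : ground_type) : minimally_vertically_connected 4 M ->
  exists j (X : {set ground_type}), [/\ e \notin X, 0 < j, j < 4 &
   [/\ j <= ground_rk X, j <= ground_rk (opp e X) &
       ground_rk X + ground_rk (opp e X) < ground_rk (~: [set e]) + j]].
Proof.
move=> [_ /(_ (val e) (valP e)) hM].
(* A finite boolean search extracts a witness from the negated universal statement. *)
pose good (j : 'I_4) (X : {set ground_type}) := [&& e \notin X, 0 < j, j <= ground_rk X,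
  j <= ground_rk (opp e X) & ground_rk X + ground_rk (opp e X) < ground_rk (~: [set e]) + j].
have [/existsP[j /existsP[X /and5P[? ? ? ? ?]]]|none] :=
  boolP [exists j : 'I_4, [exists X, good j X]]; first by exists j, X; split.
case: hM => j X Y j0 j4 [UXY dXY cXY rXY].
have {}UXY : X :|: Y = E :\ val e := UXY.
have sXE : X \subset E :\ val e by rewrite -UXY subsetUl.
have [X' EX] := lift_set_onto (subset_trans sXE (subsetDl _ _)).
have eX : e \notin X'.
  rewrite -mem_lift_set -EX; apply/negP => /(subsetP sXE).
  by rewrite !inE eqxx.
have EY : Y = lift_set (opp e X').
  rewrite /opp lift_setC lift_setU1 -EX; apply/setP => y.
  move/setP/(_ y): UXY; rewrite !inE negb_or.
  case yX : (y \in X) => /=; first by rewrite (disjointFr dXY yX) andbF.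
  by move=> ->; rewrite andbT.
have Ee : E :\ val e = lift_set (~: [set e]).
  by rewrite lift_setC /lift_set imset_set1.
case/negP: none; apply/existsP; exists (Ordinal j4); apply/existsP; exists X'.
move: rXY; rewrite leq_min EX EY /= => /andP[h1 h2].
apply/and5P; split=> //=; move: cXY; rewrite /connectivity /=.
have -> : E :\ val e :\: X = Y.
  by rewrite -UXY setDUl setDv set0U; apply/setDidPl; rewrite disjoint_sym.
by rewrite EX EY Ee -!/(ground_rk _); move: j0; clear; lia.
Qed.

Lemma ground_cocircuit C : cocirc ground_rk C -> cocircuit M (lift_set C).
Proof.
have dep X : ~~ indep (dual M) (lift_set X) = (ground_rk (~: X) < ground_rk setT).
  rewrite /indep /= lift_set_sub /=.
  have := dual_rk_add (lift_set_sub X); rewrite -lift_setC -ground_rkT.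
  rewrite -/(ground_rk _); have := ground_rkS (subsetT (~: X)).
  by case: eqP => /=; lia.
case/minsetP => rC minC; apply/minsetP; split; first by rewrite dep lift_set_sub.
move=> B /andP[sB dB] sBC; have [B' EB] := lift_set_onto sB.
by rewrite EB in dB sBC *; rewrite (minC B') // -?dep // -lift_setS.
Qed.

(** A proper subset misses some [x] of [L], so it lies in the independent pair [L :\ x]. *)
Lemma ground_triangle (L : {set ground_type}) : #|L| = 3 -> ground_rk L <= 2 ->
  (forall x y, x != y -> ground_rk [set x; y] = 2) -> triangle M (lift_set L).
Proof.
move=> cL rL pairs; rewrite /triangle card_lift_set cL eqxx andbT.
apply/minsetP; split.
  rewrite lift_set_sub /indep lift_set_sub card_lift_set -/(ground_rk L) cL /=.
  by apply: contraTneq rL => ->.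
move=> B /andP[sB dB] sBL; have [B' EB] := lift_set_onto sB.
rewrite EB in dB sBL *; congr lift_set; apply/eqP.
rewrite lift_setS in sBL; rewrite eqEcard sBL cL ltnNge; apply/negP => cB.
case/negP: dB; rewrite /indep lift_set_sub card_lift_set -/(ground_rk B') /=.
rewrite eqn_leq ground_rk_card /=.
have /card_gt0P[x xB] : 0 < #|L :\: B'|.
  by have := cardsID B' L; rewrite (setIidPr sBL) cL; lia.
rewrite inE in xB; have /andP[xB' xL] := xB.
have sBP : B' \subset L :\ x by rewrite subsetD1 sBL.
have cP : #|L :\ x| = 2 by have := cardsD1 x L; rewrite xL cL; lia.
have rP : ground_rk (L :\ x) = 2.
  have /cards2P[u [v [uv ->]]] : #|L :\ x| == 2 by rewrite cP.
  exact: pairs.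
have := ground_rkUI B' (L :\ x :\: B').
have -> : B' :|: (L :\ x :\: B') = L :\ x.
  by rewrite setDE setUIr setUCr setIT; apply/setUidPr.
have := ground_rk_card (L :\ x :\: B'); have := cardsID B' (L :\ x).
rewrite (setIidPr sBP) cP rP => h1 h2 h3.
rewrite -(leq_add2r #|L :\ x :\: B'|) h1.
by apply: leq_trans (leq_trans (leq_addr _ _) h3) _; rewrite leq_add2l.
Qed.

Lemma ground_iso (h : 'I_9 -> ground_type) : #|{: ground_type}| = 9 -> injective h ->
  (forall U : {set 'I_9}, ground_rk (h @: U) = N9_rank U) -> isomorphic M N9.
Proof.
move=> c9 h_inj rk_h.
have [g hK gK] : bijective h by apply: inj_card_bij; rewrite ?card_ord ?c9.
have [f fE] : exists f : T -> 'I_9, forall y : ground_type, f (val y) = g y.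
  by exists (fun x => if insub x is Some y then g y else ord0) => y; rewrite valK.
have imE X : f @: lift_set X = g @: X.
  by rewrite -imset_comp; apply: eq_imset.
exists f; split.
- move=> x y xE yE; have := fE (Sub x xE); have := fE (Sub y yE); rewrite !SubK.
  by move=> -> -> /(can_inj gK) /(congr1 val); rewrite !SubK.
- rewrite -[ground M]lift_setT imE; apply/setP => i; rewrite inE; apply/imsetP.
  by exists (h i); rewrite ?hK.
move=> X /lift_set_onto[X' ->]; rewrite imE N9_rkE -rk_h -imset_comp.
by rewrite (eq_imset _ (_ : _ =1 id)) ?imset_id.
Qed.

End GroundType.

Theorem theorem1p4 (T : finType) (M : matroid T)
  (hM : minimally_vertically_connected 4 M)
  (hE : 6 <= #|ground M|)
  (hN9 : ~ isomorphic M N9) :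
  (exists C : {set T}, cocircuit M C /\ #|C| = 4) \/
  (exists C : {set T}, [/\ cocircuit M C, #|C| = 5
     & exists D : {set T}, triangle M D /\ D \subset C]).
Proof.
have [/existsP[C /andP[hC /eqP cC]]|no4] :=
  boolP [exists C : {set T}, cocircuit M C && (#|C| == 4)]; first by left; exists C.
have [/existsP[C /andP[/andP[hC /eqP cC] /existsP[D /andP[tD sD]]]]|no5] :=
  boolP [exists C : {set T}, cocircuit M C && (#|C| == 5) &&
    [exists D : {set T}, triangle M D && (D \subset C)]].
  by right; exists C; split=> //; exists D.
case: hN9; have cE : #|{: ground_type M}| = #|ground M| by rewrite card_sig.
have vconn j X := @ground_connected T M j X (proj1 hM).
have minimal e := ground_minimal e hM.
have card_ge6 : 6 <= #|{: ground_type M}| by rewrite cE.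
have no_cocirc4 C : cocirc (@ground_rk T M) C -> #|C| != 4.
  move=> cC; apply: contraNneq no4 => c4; apply/existsP; exists (lift_set C).
  by rewrite ground_cocircuit // card_lift_set c4.
have no_cocirc5 (C L : {set ground_type M}) : cocirc (@ground_rk T M) C -> #|C| = 5 ->
    L \subset C -> #|L| = 3 -> ground_rk L <= 2 ->
    (forall x y : ground_type M, x != y -> ground_rk [set x; y] = 2) -> False.
  move=> cC c5 sL cL rL pairs; case/negP: no5; apply/existsP; exists (lift_set C).
  rewrite ground_cocircuit // card_lift_set c5 /=; apply/existsP; exists (lift_set L).
  by apply/andP; split; [exact: ground_triangle | rewrite lift_setS].
have [c9 [h [h_inj rk_h]]] := minimal_iso (@ground_rk_card T M) (@ground_rkS T M)
  (@ground_rkUI T M) vconn minimal card_ge6 no_cocirc4 no_cocirc5.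
exact: ground_iso c9 h_inj rk_h.
Qed.
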